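(* For each boundary face $\Gamma_i\subset\partial\Omega$ the normal-normal trace operator $\underline{\boldsymbol\tau}\mapsto \tau_{nn}|_{\Gamma_i}=((\underline{\boldsymbol\tau}\,\mathbf n)\cdot\mathbf n)|_{\Gamma_i}$ is bounded from $\underline{\mathbf H}(\operatorname{div}\mathbf{div})$ to $H^{-1/2}_n(\Gamma_i)$; thus it is well defined on $\underline{\mathbf H}(\operatorname{div}\mathbf{div})$ as the continuous extension from smooth symmetric tensor fields. That is, there is a constant $c$, independent of $\underline{\boldsymbol\tau}$, such that for all $\underline{\boldsymbol\tau}\in\underline{\mathbf H}(\operatorname{div}\mathbf{div})$ $$\|\tau_{nn}\|_{H^{-1/2}_n(\Gamma_i)}\le c\,\|\underline{\boldsymbol\tau}\|_{\underline{\mathbf H}(\operatorname{div}\mathbf{div})}.$$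
   Context: $\Omega\subset\mathbb R^3$ is a bounded, connected, polyhedral domain with Lipschitz boundary and outer unit normal $\mathbf n$; its closed polygonal boundary faces are $\Gamma_i$, $i\in\mathcal I$. The boundary is split into two closed parts $\Gamma_D$ and $\Gamma_N=\partial\Omega\setminus\mathrm{int}(\Gamma_D)$, each a union of faces $\Gamma_i$; $\Gamma_D$ is non-trivial and $\Gamma_N$ may be empty. For each connected component $\Gamma_{D,i}$ of $\Gamma_D$ there is an open Lipschitz domain $\Omega_{D,i}\subset\mathbb R^3$ with $\overline{\Omega}_{D,i}\cap\overline\Omega=\Gamma_{D,i}$ and $\Omega_{D,i}\cap\Omega=\emptyset$, these domains have mutually positive distance, and the interior of $\overline\Omega\cup\bigcup\overline\Omega_{D,i}$ is Lipschitz. $H^1_{0,\Gamma_D}=\{\varphi\in H^1(\Omega):\varphi=0\text{ on }\Gamma_D\}$. For a vector field $\mathbf v$, $\underline{\boldsymbol\varepsilon}(\mathbf v)=\frac12(\nabla\mathbf v+\nabla\mathbf v^T)$, so $\underline{\boldsymbol\varepsilon}(\nabla\varphi)=\nabla^2\varphi$. For smooth symmetric tensor fields $\underline{\boldsymbol\tau}$ on $\overline\Omega$, $$\|\underline{\boldsymbol\tau}\|_{\underline{\mathbf H}(\operatorname{div}\mathbf{div})}^2=\|\underline{\boldsymbol\tau}\|_{L^2}^2+\left(\sup_{\varphi\in H^2\cap H^1_{0,\Gamma_D}}\frac{\int_\Omega\underline{\boldsymbol\tau}:\underline{\boldsymbol\varepsilon}(\nabla\varphi)\,dx-\int_{\partial\Omega}\tau_{nn}\frac{\partial\varphi}{\partial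 n}\,ds}{\|\nabla\varphi\|_{L^2(\Omega)}}\right)^2,$$ and $\underline{\mathbf H}(\operatorname{div}\mathbf{div})$ is the closure (completion) in this norm of the smooth symmetric tensor fields on $\overline\Omega$ (those for which the norm is finite). $H^{1/2}_n(\partial\Omega)=\{\partial\tilde w/\partial n|_{\partial\Omega}:\tilde w\in H^2\cap H^1_{0,\Gamma_D}\}$ with norm $\|w\|_{H^{1/2}_n(\partial\Omega)}=\inf\{\|\nabla\tilde w\|_{H^1(\Omega)}:\tilde w\in H^2\cap H^1_{0,\Gamma_D},\ \partial\tilde w/\partial n=w\}$. $H^{-1/2}_n(\partial\Omega)$ is its dual, with dual norm $\|g\|_{H^{-1/2}_n(\partial\Omega)}=\sup_{\tilde w\in H^2\cap H^1_{0,\Gamma_D}}\langle g,\partial\tilde w/\partial n\rangle/\|\nabla\tilde w\|_{H^1}$. For a face $\Gamma_i$, $H^{1/2}_n(\Gamma_i)$ is identified, via extension by zero, with the functions in $H^{1/2}_n(\partial\Omega)$ vanishing on $\partial\Omega\setminus\Gamma_i$, with the norm of $H^{1/2}_n(\partial\Omega)$; $H^{-1/2}_n(\Gamma_i)$ is its dual with the dual norm. For smooth $\underline{\boldsymbol\tau}$, $\tau_{nn}$ acts by $\varphi\mapsto\int_{\Gamma_i}\tau_{nn}\varphi\,ds$. *)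

(* Defs.v *)
From HB Require Import structures.
From mathcomp Require Import all_boot all_order all_algebra.
From mathcomp Require Import all_classical all_reals all_analysis.
Import Order.TTheory GRing.Theory Num.Theory.
Import numFieldNormedType.Exports.

Set Implicit Arguments.
Unset Strict Implicit.
Unset Printing Implicit Defensive.

Local Open Scope classical_set_scope.
Local Open Scope ring_scope.

(* Points and vectors of R^3 are row vectors 'rV[R]_3.  Lebesgue measure on
   R^3 and R^2 is the iterated product of the one-dimensional one; it is
   carried to 'rV[R]_3 by the coordinate map [vec3]. *)

Notation plane R := (measurableTypeR R * measurableTypeR R)%type.
Notation space R :=
  (measurableTypeR R * measurableTypeR R * measurableTypeR R)%type.

Definition lebesgue2 (R : realType) : {measure set (plane R) -> \bar R} :=
  ((@lebesgue_measure R) \x (@lebesgue_measure R))%E.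

Definition lebesgue3 (R : realType) : {measure set (space R) -> \bar R} :=
  (((@lebesgue_measure R) \x (@lebesgue_measure R)) \x
    (@lebesgue_measure R))%E.

Definition vec3 (R : realType) (p : space R) : 'rV[R]_3 :=
  \row_(k < 3) [:: p.1.1 : R; p.1.2 : R; p.2 : R]`_k.

Definition e_ (R : realType) (k : 'I_3) : 'rV[R]_3 := delta_mx 0 k.

(* [A : B]; the Euclidean inner product when m = 1. *)
Definition ddot (R : realType) (m n : nat) (A B : 'M[R]_(m, n)) : R :=
  \sum_i \sum_j A i j * B i j.

(* Extended-real valued; used for nonnegative integrands. *)
Definition vint (R : realType) (Om : set 'rV[R]_3) (f : 'rV[R]_3 -> R)
  : \bar R :=
  (\int[@lebesgue3 R]_(p in @vec3 R @^-1` Om) (f (vec3 p))%:E)%E.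

(* Real valued; used for integrable integrands of any sign. *)
Definition vintR (R : realType) (Om : set 'rV[R]_3) (f : 'rV[R]_3 -> R) : R :=
  fine (vint Om f).

Definition L2 (R : realType) (Om : set 'rV[R]_3) (f : 'rV[R]_3 -> R) : Prop :=
  measurable_fun (@vec3 R @^-1` Om) (f \o @vec3 R) /\
  (vint Om (fun x => f x ^+ 2)%R < +oo)%E.

Definition L2sq (R : realType) (Om : set 'rV[R]_3) (m n : nat)
    (F : 'rV[R]_3 -> 'M[R]_(m, n)) : \bar R :=
  vint Om (fun x => ddot (F x) (F x)).

Definition L2norm (R : realType) (Om : set 'rV[R]_3) (m n : nat)
    (F : 'rV[R]_3 -> 'M[R]_(m, n)) : \bar R :=
  sqrte (L2sq Om F).

Fixpoint Cn (R : realType) (n : nat) (f : 'rV[R]_3 -> R) : Prop :=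
  match n with
  | 0%N => continuous f
  | n'.+1 => continuous f /\
      forall k : 'I_3, (forall x, derivable f x (e_ R k)) /\
                       Cn n' (fun x => 'D_(e_ R k) f x)
  end.

Definition smooth (R : realType) (f : 'rV[R]_3 -> R) : Prop :=
  forall n, Cn n f.

Definition test_function (R : realType) (Om : set 'rV[R]_3)
    (psi : 'rV[R]_3 -> R) : Prop :=
  smooth psi /\
  exists K : set 'rV[R]_3, [/\ compact K, K `<=` Om &
    forall x, ~ K x -> psi x = 0].

Definition weak_deriv (R : realType) (Om : set 'rV[R]_3) (k : 'I_3)
    (u v : 'rV[R]_3 -> R) : Prop :=
  forall psi, test_function Om psi ->
    vintR Om (fun x => u x * 'D_(e_ R k) psi x) =
    - vintR Om (fun x => v x * psi x).

(* u is in H^1(Om) and G is its weak gradient. *)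
Definition H1 (R : realType) (Om : set 'rV[R]_3)
    (u : 'rV[R]_3 -> R) (G : 'rV[R]_3 -> 'rV[R]_3) : Prop :=
  [/\ L2 Om u,
      forall k, L2 Om (fun x => G x 0 k) &
      forall k, weak_deriv Om k u (fun x => G x 0 k)].

Definition bdry (R : realType) (A : set 'rV[R]_3) : set 'rV[R]_3 :=
  closure A `\` A°.

(* For an open set U: near each boundary point, and up to a rigid motion, U is
   the region below the graph of a Lipschitz function. *)
Definition lipschitz_boundary (R : realType) (U : set 'rV[R]_3) : Prop :=
  forall x, bdry U x ->
  exists (Q : 'M[R]_3) (r h : R) (g : R * R -> R),
    [/\ Q *m Q^T = 1%:M, 0 < r, 0 < h, lipschitz g &
        forall z, let y := (z - x) *m Q in
          `|y 0 0| < r -> `|y 0 1| < r -> `|y 0 2%:R| < h ->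
          (U z <-> y 0 2%:R < g (y 0 0, y 0 1))].

Definition triangle (R : realType) (a b c : R * R) : set (R * R) :=
  [set p | exists s t : R, [/\ 0 <= s, 0 <= t, s + t <= 1 &
     p = a + s *: (b - a) + t *: (c - a)]].

Definition nondegenerate (R : realType) (a b c : R * R) : Prop :=
  (b.1 - a.1) * (c.2 - a.2) - (b.2 - a.2) * (c.1 - a.1) != 0.

(* Closed polygons, not necessarily convex or simply connected. *)
Definition polygon (R : realType) (S : set (R * R)) : Prop :=
  connected S° /\
  exists (n : nat) (a b c : 'I_n.+1 -> R * R),
    (forall k, nondegenerate (a k) (b k) (c k)) /\
    S = \bigcup_k triangle (a k) (b k) (c k).

Definition plane_chart (R : realType) (o t1 t2 : 'rV[R]_3) (p : R * R)
  : 'rV[R]_3 := o + p.1 *: t1 + p.2 *: t2.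

(* Each boundary face is given by a closed polygon in R^2 and an isometric
   parametrization of its plane, so that its area measure is the image of the
   plane Lebesgue measure. *)
Record polyhedral_domain (R : realType) := PolyhedralDomain {
  dom : set 'rV[R]_3 ;
  dom_open : open dom ;
  dom_neq0 : dom !=set0 ;
  dom_connected : connected dom ;
  dom_bounded : bounded_set dom ;
  dom_lipschitz : lipschitz_boundary dom ;
  faces : finType ;
  forigin : faces -> 'rV[R]_3 ;
  ftan1 : faces -> 'rV[R]_3 ;
  ftan2 : faces -> 'rV[R]_3 ;
  fnormal : faces -> 'rV[R]_3 ;
  fpoly : faces -> set (R * R) ;
  ftan1_unit : forall i, ddot (ftan1 i) (ftan1 i) = 1 ;
  ftan2_unit : forall i, ddot (ftan2 i) (ftan2 i) = 1 ;
  fnormal_unit : forall i, ddot (fnormal i) (fnormal i) = 1 ;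
  ftan_ortho : forall i, ddot (ftan1 i) (ftan2 i) = 0 ;
  fnormal_ortho1 : forall i, ddot (fnormal i) (ftan1 i) = 0 ;
  fnormal_ortho2 : forall i, ddot (fnormal i) (ftan2 i) = 0 ;
  fpoly_polygon : forall i, polygon (fpoly i) ;
  faces_cover : bdry dom = \bigcup_i
    (plane_chart (forigin i) (ftan1 i) (ftan2 i) @` fpoly i) ;
  faces_disjoint : forall i j, i != j ->
    (plane_chart (forigin i) (ftan1 i) (ftan2 i) @` (fpoly i)°) `&`
    (plane_chart (forigin j) (ftan1 j) (ftan2 j) @` (fpoly j)°) = set0 ;
  fnormal_outer : forall i p, (fpoly i)° p ->
    \forall t \near 0^'+,
      dom (plane_chart (forigin i) (ftan1 i) (ftan2 i) p - t *: fnormal i) /\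
      ~ closure dom
          (plane_chart (forigin i) (ftan1 i) (ftan2 i) p + t *: fnormal i)
}.

Definition fchart (R : realType) (P : polyhedral_domain R) (i : faces P) :=
  plane_chart (forigin i) (ftan1 i) (ftan2 i).

Definition face (R : realType) (P : polyhedral_domain R) (i : faces P)
  : set 'rV[R]_3 := fchart i @` fpoly i.

Definition fint (R : realType) (P : polyhedral_domain R) (i : faces P)
    (f : 'rV[R]_3 -> R) : \bar R :=
  (\int[@lebesgue2 R]_(p in (fpoly i : set (plane R)))
     (f (fchart i p))%:E)%E.

Definition fintR (R : realType) (P : polyhedral_domain R) (i : faces P)
    (f : 'rV[R]_3 -> R) : R := fine (fint i f).

Definition face_measurable (R : realType) (P : polyhedral_domain R)
    (i : faces P) (f : 'rV[R]_3 -> R) : Prop :=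
  measurable_fun (fpoly i : set (plane R)) (f \o fchart i).

Definition ae_face (R : realType) (P : polyhedral_domain R) (i : faces P)
    (A : 'rV[R]_3 -> Prop) : Prop :=
  {ae @lebesgue2 R, forall p : plane R, fpoly i p -> A (fchart i p)}.

Definition Gamma_D (R : realType) (P : polyhedral_domain R)
    (D : set (faces P)) : set 'rV[R]_3 := \bigcup_(i in D) face i.

Definition Gamma_N (R : realType) (P : polyhedral_domain R)
    (D : set (faces P)) : set 'rV[R]_3 :=
  bdry (dom P) `\`
  [set x | Gamma_D D x /\
     \forall y \near x, bdry (dom P) y -> Gamma_D D y].

Definition components (R : realType) (A : set 'rV[R]_3)
  : set (set 'rV[R]_3) := [set connected_component A x | x in A].

(* [O C] is the exterior domain attached to the component C of Gamma_D. *)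
Definition dirichlet_part (R : realType) (P : polyhedral_domain R)
    (D : set (faces P)) : Prop :=
  [/\ D !=set0,
      (exists N : set (faces P), Gamma_N D = \bigcup_(i in N) face i) &
      exists O : set 'rV[R]_3 -> set 'rV[R]_3,
      [/\ (forall C, components (Gamma_D D) C ->
             [/\ open (O C), connected (O C) & lipschitz_boundary (O C)]),
          (forall C, components (Gamma_D D) C ->
             closure (O C) `&` closure (dom P) = C /\
             O C `&` dom P = set0),
          (forall C C', components (Gamma_D D) C ->
             components (Gamma_D D) C' -> C <> C' ->
             exists2 d : R, 0 < d &
               forall x y, O C x -> O C' y -> d <= `|x - y|) &
          lipschitz_boundary
            (closure (dom P) `|`
             \bigcup_(C in components (Gamma_D D)) closure (O C))°]].

(* For u in H^1 with weak gradient G: b is the L^2 boundary trace of u, that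
   is, the value at u of the continuous extension from smooth functions on the
   closed domain of the restriction to the boundary. *)
Definition trace (R : realType) (P : polyhedral_domain R)
    (u : 'rV[R]_3 -> R) (G : 'rV[R]_3 -> 'rV[R]_3) (b : 'rV[R]_3 -> R)
  : Prop :=
  [/\ H1 (dom P) u G,
      (forall i : faces P, face_measurable i b /\
         (fint i (fun x => b x ^+ 2)%R < +oo)%E) &
      exists v : nat -> 'rV[R]_3 -> R,
      [/\ forall n, smooth (v n),
          (fun n => (vint (dom P) (fun x => (v n x - u x) ^+ 2)%R +
             \sum_(k < 3)
               vint (dom P) (fun x => ('D_(e_ R k) (v n) x - G x 0 k) ^+ 2)%R)%E)
            @ \oo --> 0%E &
          (fun n => (\sum_(i : faces P)
             fint i (fun x => (v n x - b x) ^+ 2)%R)%E) @ \oo --> 0%E]].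

(* An element of the intersection of H^2 and H^1_{0,Gamma_D} bundled with its
   weak first and second derivatives and the trace of its gradient; these are
   determined by [fn] up to null sets. *)
Record H2_0D (R : realType) (P : polyhedral_domain R) (D : set (faces P)) :=
  MkH2_0D {
  fn : 'rV[R]_3 -> R ;
  grad : 'rV[R]_3 -> 'rV[R]_3 ;
  hess : 'rV[R]_3 -> 'M[R]_3 ;
  gtr : 'rV[R]_3 -> 'rV[R]_3 ;
  fn_H1 : H1 (dom P) fn grad ;
  grad_H1 : forall k,
    H1 (dom P) (fun x => grad x 0 k) (fun x => row k (hess x)) ;
  fn_D : exists2 b, trace P fn grad b &
    forall i, D i -> ae_face i (fun x => b x = 0) ;
  gtr_trace : forall k,
    trace P (fun x => grad x 0 k) (fun x => row k (hess x))
      (fun x => gtr x 0 k)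
}.

Definition dn (R : realType) (P : polyhedral_domain R) (D : set (faces P))
    (phi : H2_0D D) (i : faces P) (x : 'rV[R]_3) : R :=
  ddot (gtr phi x) (fnormal i).

(* The strain epsilon(v) as a function of the Jacobian J of v. *)
Definition eps (R : realType) (J : 'M[R]_3) : 'M[R]_3 := 2^-1 *: (J + J^T).

Definition nn (R : realType) (P : polyhedral_domain R)
    (tau : 'rV[R]_3 -> 'M[R]_3) (i : faces P) (x : 'rV[R]_3) : R :=
  (fnormal i *m (tau x *m (fnormal i)^T)) 0 0.

Definition divdiv (R : realType) (P : polyhedral_domain R)
    (D : set (faces P)) (tau : 'rV[R]_3 -> 'M[R]_3) (phi : H2_0D D) : R :=
  vintR (dom P) (fun x => ddot (tau x) (eps (hess phi x))) -
  \sum_(i : faces P) fintR i (fun x => nn tau i x * dn phi i x).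

(* In \bar R, 0 / 0 = 0 and a / 0 = +oo for a > 0: here and in the dual norm
   below, quotients 0 / 0 do not contribute to the supremum. *)
Definition normdd (R : realType) (P : polyhedral_domain R)
    (D : set (faces P)) (tau : 'rV[R]_3 -> 'M[R]_3) : \bar R :=
  sqrte (L2sq (dom P) tau +
    ereal_sup [set ((divdiv tau phi)%:E / L2norm (dom P) (grad phi))%E
              | phi in [set: H2_0D D]] ^+ 2)%E.

(* Smooth symmetric tensor fields of finite norm.  Fields on the closed domain
   are represented by smooth extensions to R^3. *)
Definition smooth_Hdd (R : realType) (P : polyhedral_domain R)
    (D : set (faces P)) (tau : 'rV[R]_3 -> 'M[R]_3) : Prop :=
  [/\ forall k l, smooth (fun x => tau x k l),
      forall x, (tau x)^T = tau x &
      (normdd D tau < +oo)%E].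

(* (H, iota) is a completion of the smooth fields for [normdd]; values of iota
   outside [smooth_Hdd] are irrelevant. *)
Definition is_Hdivdiv (R : realType) (P : polyhedral_domain R)
    (D : set (faces P)) (H : completeNormedModType R)
    (iota : ('rV[R]_3 -> 'M[R]_3) -> H) : Prop :=
  [/\ forall (a : R) tau sigma, smooth_Hdd D tau -> smooth_Hdd D sigma ->
        iota (fun x => a *: tau x + sigma x) = a *: iota tau + iota sigma,
      forall tau, smooth_Hdd D tau -> `|iota tau|%:E = normdd D tau &
      closure (iota @` smooth_Hdd D) = [set: H]].

Definition has_dn (R : realType) (P : polyhedral_domain R)
    (D : set (faces P)) (w : 'rV[R]_3 -> R) : set (H2_0D D) :=
  [set phi | forall i, ae_face i (fun x => dn phi i x = w x)].

Definition Hn12 (R : realType) (P : polyhedral_domain R)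
    (D : set (faces P)) : set ('rV[R]_3 -> R) :=
  [set w | (forall i : faces P, face_measurable i w) /\
           has_dn (D := D) w !=set0].

Definition Hn12_norm (R : realType) (P : polyhedral_domain R)
    (D : set (faces P)) (w : 'rV[R]_3 -> R) : \bar R :=
  ereal_inf
    [set (sqrte (L2sq (dom P) (grad phi) + L2sq (dom P) (hess phi)))%E
    | phi in has_dn (D := D) w].

(* H^{1/2}_n of the face i, identified with extensions by zero. *)
Definition Hn12_face (R : realType) (P : polyhedral_domain R)
    (D : set (faces P)) (i : faces P) : set ('rV[R]_3 -> R) :=
  [set w | Hn12 D w /\
           forall j, j != i -> ae_face j (fun x => w x = 0)].

Definition Hn12_dual_norm (R : realType) (P : polyhedral_domain R)
    (D : set (faces P)) (i : faces P) (g : ('rV[R]_3 -> R) -> R) : \bar R :=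
  ereal_sup [set ((g w)%:E / Hn12_norm D w)%E | w in Hn12_face D i].

(* H^{-1/2}_n of the face i: only the values on [Hn12_face] matter, and
   boundedness makes g insensitive to null sets. *)
Definition Hn12_dual (R : realType) (P : polyhedral_domain R)
    (D : set (faces P)) (i : faces P) : set (('rV[R]_3 -> R) -> R) :=
  [set g | (forall (a : R) w1 w2, Hn12_face D i w1 -> Hn12_face D i w2 ->
              g (fun x => a * w1 x + w2 x) = a * g w1 + g w2) /\
           (Hn12_dual_norm D i g < +oo)%E].

Definition nn_functional (R : realType) (P : polyhedral_domain R)
    (i : faces P) (tau : 'rV[R]_3 -> 'M[R]_3) (w : 'rV[R]_3 -> R) : R :=
  fintR i (fun x => nn tau i x * w x).

(* T is a bounded linear map from H to H^{-1/2}_n of the face i that agrees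
   with tau |-> tau_nn on smooth fields. *)
Definition nn_trace_extension (R : realType) (P : polyhedral_domain R)
    (D : set (faces P)) (i : faces P) (H : completeNormedModType R)
    (iota : ('rV[R]_3 -> 'M[R]_3) -> H) (T : H -> ('rV[R]_3 -> R) -> R)
  : Prop :=
  [/\ forall h, Hn12_dual D i (T h),
      forall (a : R) h1 h2 w, Hn12_face D i w ->
        T (a *: h1 + h2) w = a * T h1 w + T h2 w,
      forall tau w, smooth_Hdd D tau -> Hn12_face D i w ->
        T (iota tau) w = nn_functional i tau w &
      exists C : R, forall h, (Hn12_dual_norm D i (T h) <= (C * `|h|)%:E)%E].

(* Main.v *)
Require Import Defs.
From HB Require Import structures.
From mathcomp Require Import all_boot all_order all_algebra.
From mathcomp Require Import all_classical all_reals all_analysis.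
From mathcomp Require Import measurable_realfun.
From mathcomp Require Import ring lra.
Import Order.TTheory GRing.Theory Num.Theory.
Import numFieldNormedType.Exports.
Local Open Scope classical_set_scope.
Local Open Scope ring_scope.

(* If w vanishes off the face i and is the normal derivative of phi, the
   boundary term in [divdiv tau phi] only sees the face i, so that
     <tau_nn, w> = int tau : hess phi - divdiv tau phi.
   By Cauchy-Schwarz the right-hand side is at most
     |tau| |hess phi| + S |grad phi|
       <= sqrt (|tau|^2 + S^2) sqrt (|grad phi|^2 + |hess phi|^2),
   where S is the supremum in [normdd]; the infimum over phi gives the bound
   with constant 1.  The extension to the completion is done for each w
   separately, which avoids showing that H^{1/2}_n is a vector space. *)

Set Implicit Arguments.
Unset Strict Implicit.
Unset Printing Implicit Defensive.

(** * Continuous extension from a dense subset *)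

(** Both uses of Cauchy-Schwarz, for the volume integral and for the final product of square roots,
    are replaced by one AM-GM estimate with a common free weight [t], optimised only at the end. The
    integral estimates thus stay linear in the squared norms, and no factor larger than 1 appears.
    The supremum in [normdd] runs over signed quotients. Bounding the absolute value of
    [divdiv tau phi] therefore requires negating [phi] together with its derivatives and traces. All
    norms are extended reals. Finiteness of [normdd] has to exclude an infinite supremum of either
    sign, because the supremum is squared, and a vanishing denominator has to be shown harmless. On
    the completion, an extended value is described by an estimate against all smooth fields instead
    of a limit of a chosen sequence; linearity, bounds and uniqueness then follow from density. *)

Lemma le_sqrt_mul (R : realType) (g X Y : R) : 0 <= X -> 0 <= Y ->
  (forall t, 0 < t -> g <= t / 2 * X + (2 * t)^-1 * Y) ->
  g <= Num.sqrt X * Num.sqrt Y.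
Proof.
move=> X0 Y0 gle; set x := Num.sqrt X; set y := Num.sqrt Y.
have x0 : 0 <= x by exact: sqrtr_ge0.
have y0 : 0 <= y by exact: sqrtr_ge0.
apply/ler_addgt0Pr => e e0.
pose d := e / (x + y + 1).
have s0 : 0 < x + y + 1 by lra.
have d0 : 0 < d by rewrite divr_gt0.
have dE : d * (x + y + 1) = e by rewrite /d divfK// gt_eqF.
have xd0 : 0 < x + d by lra.
have yd0 : 0 < y + d by lra.
(* The optimal weight is [y / x]. The shift by [d] covers vanishing [x] or [y] and costs
   [d * (x + y) / 2], which is at most [e] by the choice of [d]. *)
have t0 : 0 < (y + d) / (x + d) by rewrite divr_gt0.
apply: (le_trans (gle _ t0)).
rewrite -(sqr_sqrtr X0) -(sqr_sqrtr Y0) -/x -/y.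
have h1 : x ^+ 2 / (x + d) <= x by rewrite ler_pdivrMr// expr2; nra.
have h2 : y ^+ 2 / (y + d) <= y by rewrite ler_pdivrMr// expr2; nra.
have -> : (y + d) / (x + d) / 2 * x ^+ 2 + (2 * ((y + d) / (x +
  d)))^-1 * y ^+ 2 =
   2^-1 * ((y + d) * (x ^+ 2 / (x + d)) + (x + d) * (y ^+ 2 / (y + d))).
  by field; rewrite !gt_eqF.
have h3 := ler_wpM2l (ltW yd0) h1.
have h4 := ler_wpM2l (ltW xd0) h2.
nra.
Qed.

(* [y] is the value at [h] of the continuous extension of [L] along [iota].  As
   [K] may depend on [L], a combination of such values is again one, whether or
   not the combination of the [L]'s belongs to any given family. *)
Definition extension_value (R : realType) (X : Type) (H : normedModType R)
    (E : set X) (iota : X -> H) (L : X -> R) (h : H) (y : R) : Prop :=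
  exists K : R, forall x, E x -> `|L x - y| <= K * `|iota x - h|.

(** The type [X] carries no algebraic structure, so a linear combination is only asked to be
    realised by some element of [E], both under [iota] and under [L]. *)
Definition linear_on (R : realType) (X : Type) (H : normedModType R)
    (E : set X) (iota : X -> H) (L : X -> R) : Prop :=
  forall a x x', E x -> E x' -> exists z,
    [/\ E z, iota z = a *: iota x + iota x' & L z = a * L x + L x'].

Lemma dense_approx (R : realType) (X : Type) (H : normedModType R)
    (E : set X) (iota : X -> H) (h : H) (e : R) :
  closure (iota @` E) = [set: H] -> 0 < e ->
  exists2 x, E x & `|iota x - h| < e.
Proof.
move=> clE e0.
have : closure (iota @` E) h by rewrite clE.
move=> /(_ _ (nbhsx_ballx h e e0)) [_ [[x Ex <-]]].
by rewrite -ball_normE /= distrC => ?; exists x.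
Qed.

(** Both estimates are evaluated at one [x] whose image is close to [h]. Identities for the
    extension thereby reduce to checking that the two sides are extension values of the same
    functional at the same point. *)
Lemma extension_value_unique (R : realType) (X : Type) (H : normedModType R)
    (E : set X) (iota : X -> H) (L : X -> R) (h : H) (y y' : R) :
  closure (iota @` E) = [set: H] ->
  extension_value E iota L h y -> extension_value E iota L h y' -> y = y'.
Proof.
move=> clE [K hK] [K' hK']; apply/eqP; rewrite -subr_eq0 -normr_le0.
apply/ler_addgt0Pr => e e0; rewrite add0r.
pose M := `|K| + `|K'| + 1.
have M0 : 0 < M by rewrite ltr_wpDl// addr_ge0.
have [x Ex xh] := dense_approx h clE (divr_gt0 e0 M0).
have -> : y - y' = (L x - y') - (L x - y) by ring.
apply: (le_trans (ler_normB _ _)).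
have h1 := hK _ Ex; have h2 := hK' _ Ex.
have n0 : 0 <= `|iota x - h| by [].
have k1 : K * `|iota x - h| <= `|K| * `|iota x - h|.
  by rewrite ler_wpM2r// ler_norm.
have k2 : K' * `|iota x - h| <= `|K'| * `|iota x - h|.
  by rewrite ler_wpM2r// ler_norm.
move: xh; rewrite ltr_pdivlMr// /M => xh.
lra.
Qed.

Lemma extension_value_le (R : realType) (X : Type) (H : normedModType R)
    (E : set X) (iota : X -> H) (L : X -> R) (C : R) (h : H) (y : R) :
  closure (iota @` E) = [set: H] -> 0 <= C ->
  (forall x, E x -> `|L x| <= C * `|iota x|) ->
  extension_value E iota L h y -> `|y| <= C * `|h|.
Proof.
move=> clE C0 hC [K hK].
apply/ler_addgt0Pr => e e0.
pose M := `|K| + C + 1.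
have M0 : 0 < M by rewrite ltr_wpDl// addr_ge0.
have [x Ex xh] := dense_approx h clE (divr_gt0 e0 M0).
have -> : y = L x - (L x - y) by ring.
apply: (le_trans (ler_normB _ _)).
have h1 := hK _ Ex; have h2 := hC _ Ex.
have k1 : K * `|iota x - h| <= `|K| * `|iota x - h|.
  by rewrite ler_wpM2r// ler_norm.
have k2 : `|iota x| <= `|iota x - h| + `|h|.
  by rewrite -{1}(subrK h (iota x)) ler_normD.
have k3 := ler_wpM2l C0 k2.
move: xh; rewrite ltr_pdivlMr// /M => xh.
have n0 : 0 <= `|iota x - h| by [].
lra.
Qed.

(** The bound is applied to an element that realises the difference. In particular [L x] depends on
    [x] in [E] only through [iota x]. *)
Lemma bounded_linear_lipschitz (R : realType) (X : Type) (H : normedModType R)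
    (E : set X) (iota : X -> H) (L : X -> R) (C : R) (x x' : X) :
  linear_on E iota L -> (forall x, E x -> `|L x| <= C * `|iota x|) ->
  E x -> E x' -> `|L x - L x'| <= C * `|iota x - iota x'|.
Proof.
move=> lin hC Ex Ex'; have [z [Ez iz Lz]] := lin (-1) _ _ Ex' Ex.
have := hC _ Ez; rewrite iz Lz mulN1r scaleN1r.
by rewrite [- L _ + _]addrC [- iota _ + _]addrC.
Qed.

Lemma extension_value_point (R : realType) (X : Type) (H : normedModType R)
    (E : set X) (iota : X -> H) (L : X -> R) (C : R) (x : X) :
  linear_on E iota L -> (forall x, E x -> `|L x| <= C * `|iota x|) ->
  E x -> extension_value E iota L (iota x) (L x).
Proof.
move=> lin hC Ex; exists C => x' Ex'.
exact: (bounded_linear_lipschitz lin hC Ex' Ex).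
Qed.

(* McShane's formula for the extension of a Lipschitz function. *)
Lemma extension_value_exists (R : realType) (X : Type) (H : normedModType R)
    (E : set X) (iota : X -> H) (L : X -> R) (C : R) (h : H) :
  linear_on E iota L -> 0 <= C ->
  (forall x, E x -> `|L x| <= C * `|iota x|) -> E !=set0 ->
  exists y, extension_value E iota L h y.
Proof.
move=> lin C0 hC [x0 Ex0].
pose A := [set L x - C * `|iota x - h| | x in E].
have up x' : E x' -> ubound A (L x' + C * `|iota x' - h|).
  move=> Ex' _ [x Ex <-].
  have l1 := bounded_linear_lipschitz lin hC Ex Ex'.
  have l2 : `|iota x - iota x'| <= `|iota x - h| + `|iota x' - h|.
    by rewrite [`|iota x' - h|]distrC ler_distD.
  have l3 := ler_wpM2l C0 l2.
  have l4 := le_trans (ler_norm _) l1.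
  lra.
have hA : has_sup A.
  by split; [exists (L x0 - C * `|iota x0 - h|), x0|exists (L x0 +
    C * `|iota x0 - h|); exact: up].
exists (sup A), C => x Ex.
have u1 : sup A <= L x + C * `|iota x - h| by apply: ge_sup;
  [exact: hA.1|exact: up].
have u2 : L x - C * `|iota x - h| <= sup A by apply: ub_le_sup;
  [exact: hA.2|exists x].
rewrite ler_norml; apply/andP; split; lra.
Qed.

Lemma extension_valueDl (R : realType) (X : Type) (H : normedModType R)
    (E : set X) (iota : X -> H) (L1 L2 L : X -> R) (a : R) (h : H) (y1 y2 : R) :
  (forall x, E x -> L x = a * L1 x + L2 x) ->
  extension_value E iota L1 h y1 -> extension_value E iota L2 h y2 ->
  extension_value E iota L h (a * y1 + y2).
Proof.
move=> LE [K1 h1] [K2 h2]; exists (`|a| * K1 + K2) => x Ex.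
rewrite LE//.
have -> : a * L1 x + L2 x - (a * y1 + y2) = a * (L1 x - y1) + (L2 x - y2)
  by ring.
rewrite mulrDl (le_trans (ler_normD _ _))// lerD ?h2// normrM -mulrA.
by apply: ler_wpM2l => //; exact: h1.
Qed.

(** Choose [x1], [x2] with images close to [h1], [h2], and let [z] realise their combination. Then
    [L z] is close to [a * y1 + y2], and [L x] is compared with [L z] by the Lipschitz bound. The
    number [M] collects the coefficients of all approximation errors. *)
Lemma extension_valueDr (R : realType) (X : Type) (H : normedModType R)
    (E : set X) (iota : X -> H) (L : X -> R) (C a : R) (h1 h2 : H) (y1 y2 : R) :
  closure (iota @` E) = [set: H] ->
  linear_on E iota L -> 0 <= C ->
  (forall x, E x -> `|L x| <= C * `|iota x|) ->
  extension_value E iota L h1 y1 -> extension_value E iota L h2 y2 ->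
  extension_value E iota L (a *: h1 + h2) (a * y1 + y2).
Proof.
move=> clE lin C0 hC [K1 hK1] [K2 hK2]; exists C => x Ex.
apply/ler_addgt0Pr => e e0.
pose M := `|a| * `|K1| + `|K2| + C * `|a| + C + 1.
have a0 : 0 <= `|a| by [].
have M0 : 0 < M by rewrite ltr_wpDl// !addr_ge0// mulr_ge0.
have [x1 Ex1 xh1] := dense_approx h1 clE (divr_gt0 e0 M0).
have [x2 Ex2 xh2] := dense_approx h2 clE (divr_gt0 e0 M0).
set d := e / M in xh1 xh2.
have dM : d * M = e by rewrite divfK// gt_eqF.
have [z [Ez iz Lz]] := lin a _ _ Ex1 Ex2.
have -> : L x - (a * y1 + y2) = (L x - L z) + (a * (L x1 - y1) + (L x2 - y2)).
  by rewrite Lz; ring.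
have l1 := bounded_linear_lipschitz lin hC Ex Ez.
have l2 : `|iota x - iota z| <=
    `|iota x - (a *: h1 + h2)| + (`|a| * d + d).
  have -> : iota x - iota z =
      (iota x - (a *: h1 + h2)) - (a *: (iota x1 - h1) + (iota x2 - h2)).
    by rewrite iz scalerBr addrACA -opprD opprB addrA subrK.
  rewrite (le_trans (ler_normB _ _))// lerD2l (le_trans (ler_normD _ _))//.
  apply: lerD; last exact: ltW.
  by rewrite normrZ; apply: ler_wpM2l => //; exact: ltW.
have l3 := le_trans l1 (ler_wpM2l C0 l2).
have l4 : `|a * (L x1 - y1) + (L x2 - y2)| <= `|a| * (`|K1| * d) + `|K2| * d.
  rewrite (le_trans (ler_normD _ _))// lerD//.
    rewrite normrM ler_wpM2l// (le_trans (hK1 _ Ex1))//.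
    by rewrite (le_trans (ler_wpM2r _ (ler_norm K1)))// ler_wpM2l// ltW.
  rewrite (le_trans (hK2 _ Ex2))//.
  by rewrite (le_trans (ler_wpM2r _ (ler_norm K2)))// ler_wpM2l// ltW.
apply: (le_trans (ler_normD _ _)); apply: (le_trans (lerD l3 l4)).
rewrite -dM /M.
have d0 : 0 <= d by rewrite divr_ge0// ltW.
nra.
Qed.

(** * Measurability and boundedness on open sets and polygons *)

Lemma vec3E (R : realType) (p : Defs.space R) (i : 'I_1) (k : 'I_3) :
  vec3 p i k = [:: p.1.1 : R; p.1.2 : R; p.2 : R]`_k.
Proof. by rewrite mxE. Qed.

Definition rat_box (R : realType) (c : rat * rat * rat * nat) :
  set (Defs.space R) :=
  ((ball (ratr c.1.1.1 : R) c.2.+1%:R^-1 `*` ball (ratr c.1.1.2 :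
    R) c.2.+1%:R^-1)
   `*` ball (ratr c.1.2 : R) c.2.+1%:R^-1).

Lemma measurable_rat_box (R : realType) c : measurable (@rat_box R c).
Proof.
by apply: measurableX; first apply: measurableX; apply: open_measurable;
  exact: ball_open.
Qed.

Lemma rat_ball (R : realType) (x e : R) : 0 < e -> exists q :
  rat, ball (ratr q : R) e x.
Proof.
move=> e0; have [|q] := @rat_in_itvoo R (x - e) (x + e); first lra.
rewrite in_itv /= => /andP[h1 h2]; exists q; rewrite -ball_normE /= ltr_norml.
by apply/andP; split; lra.
Qed.

(** This links the topology of row vectors to the product sigma-algebra: the preimage is the union
    of the countably many rational cubes inside it, and each cube is a measurable rectangle. *)
Lemma open_vec3_measurable (R : realType) (U : set 'rV[R]_3) :
  open U -> measurable (@vec3 R @^-1` U).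
Proof.
move=> oU.
pose F c : set (Defs.space R) :=
  if `[< rat_box c `<=` @vec3 R @^-1` U >] then @rat_box R c else set0.
have -> : @vec3 R @^-1` U = \bigcup_c F c.
  apply/seteqP; split=> [p /= Up|p [c _]]; last first.
    by rewrite /F; case: asboolP => // h /h.
  have [e /= e0 eU] : nbhs_ball (vec3 p) U by apply/nbhs_ballP/open_nbhs_nbhs.
  (* Half of [e] is enough room: [p] and any other point of the cube both lie within the radius of
     the rational centre. *)
  have e20 : 0 < e / 2 by rewrite divr_gt0.
  have [n _ /(_ n (leqnn n)) ne] := near_infty_natSinv_lt (PosNum e20).
  have {}ne : n.+1%:R^-1 < e / 2 by exact: ne.
  have n0 : 0 < n.+1%:R^-1 :> R by rewrite invr_gt0.
  have [q1 h1] := rat_ball (p.1.1 : R) n0.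
  have [q2 h2] := rat_ball (p.1.2 : R) n0.
  have [q3 h3] := rat_ball (p.2 : R) n0.
  exists (q1, q2, q3, n) => //; rewrite /F; case: asboolP => [_//|[]].
  move=> y [[/= y1 y2] y3]; apply: eU; rewrite /ball/= /mx_ball; split=> // i k.
  have near2 (a b : R) (q : rat) : ball (ratr q : R) n.+1%:R^-1 a ->
      ball (ratr q : R) n.+1%:R^-1 b -> ball a e b.
    move=> /ball_sym aq qb; have := ball_triangle aq qb.
    apply: le_ball; move: ne; set r := _^-1; lra.
  rewrite !vec3E; case: k => [[|[|[|//]]] ?] /=;
    [exact: near2 h1 y1|exact: near2 h2 y2|exact: near2 h3 y3].
by apply: countable_bigcupT_measurable => // c; rewrite /F; case: ifP => // _;
  exact: measurable_rat_box.
Qed.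

Lemma continuous_vec3_measurable (R : realType) (f : 'rV[R]_3 -> R)
    (D : set (Defs.space R)) :
  continuous f -> measurable_fun D (f \o @vec3 R).
Proof.
move=> /continuousP cf.
apply: (@measurable_funS _ _ _ _ setT) => //.
apply: (measurability _ (RGenOpens.measurableE R)).
move=> _ [_ [a [b ->] <-]]; rewrite setTI comp_preimage.
apply: open_vec3_measurable; apply: cf.
exact: interval_open.
Qed.

(** Padding a point of the plane with a third coordinate 0 makes the measurability and compactness
    arguments of three-space available on the faces. *)
Lemma continuous_chart_factor (R : realType) (f : 'rV[R]_3 -> R)
    (o t1 t2 : 'rV[R]_3) :
  continuous f -> exists2 g : 'rV[R]_3 -> R, continuous g &
    forall p : plane R, f (plane_chart o t1 t2 p) = g (vec3 (p, 0)).
Proof.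
move=> cf; pose A (x : 'rV[R]_3) := o + x 0 0 *: t1 + x 0 1 *: t2.
exists (f \o A) => [x|p]; last by rewrite /= /A /plane_chart !vec3E.
apply: continuous_comp; last exact: cf.
have h k (t : 'rV[R]_3) :
    (y 0 k : R) *: t @[y --> (x : 'rV[R]_3)] --> x 0 k *: t.
  by apply: cvgZr_tmp; exact: coord_continuous.
exact: (cvgD (cvgD (cvg_cst _) (h 0 t1)) (h 1 t2)).
Qed.

Lemma continuous_chart_measurable (R : realType) (f : 'rV[R]_3 -> R)
    (o t1 t2 : 'rV[R]_3) (D : set (plane R)) :
  continuous f -> measurable_fun D (f \o plane_chart o t1 t2).
Proof.
move=> cf; apply: (@measurable_funS _ _ _ _ setT) => //.
have [g cg fg] := continuous_chart_factor o t1 t2 cf.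
have -> : f \o plane_chart o t1 t2 =
    (g \o @vec3 R) \o (fun p : plane R => (p, 0 : measurableTypeR R)).
  by apply/funext => p; exact: fg.
apply: measurableT_comp; first exact: continuous_vec3_measurable.
exact: measurable_fun_pair.
Qed.

Lemma triangle_measurable (R : realType) (a b c : R * R) :
  Defs.nondegenerate a b c -> measurable (triangle a b c : set (plane R)).
Proof.
move=> nd; rewrite /Defs.nondegenerate in nd; set dt := (X in X != 0) in nd.
(* Cramer's rule: [s] and [t] recover the two affine coordinates of a point, with the nonzero
   determinant [dt] as denominator. The triangle is then cut out by three inequalities between
   measurable functions. *)
pose s (p : plane R) :
  R := dt^-1 * ((p.1 - a.1) * (c.2 - a.2) - (p.2 - a.2) * (c.1 - a.1)).
pose t (p : plane R) :
  R := dt^-1 * ((b.1 - a.1) * (p.2 - a.2) - (b.2 - a.2) * (p.1 - a.1)).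
have m1 (x : R) : measurable_fun [set: plane R] (fun p :
  plane R => (p.1 - x : R)).
  by apply: measurable_funB => //; exact: measurable_fst.
have m2 (x : R) : measurable_fun [set: plane R] (fun p :
  plane R => (p.2 - x : R)).
  by apply: measurable_funB => //; exact: measurable_snd.
have ms : measurable_fun [set: plane R] s.
  by apply: measurable_funM => //; apply: measurable_funB;
    exact: measurable_funM.
have mt : measurable_fun [set: plane R] t.
  by apply: measurable_funM => //; apply: measurable_funB;
    exact: measurable_funM.
have -> : (triangle a b c : set (plane R)) =
    s @^-1` `[0, +oo[ `&` t @^-1` `[0, +oo[ `&` (s \+ t) @^-1` `]-oo, 1].
  apply/seteqP; split=> [p [u [v [u0 v0 uv pE]]]|p].
    have su : s p = u.
      by rewrite /s pE /= /GRing.scale /= /dt; field.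
    have tv : t p = v.
      by rewrite /t pE /= /GRing.scale /= /dt; field.
    by rewrite /= su tv !in_itv /= u0 v0 uv.
  rewrite /= !in_itv /= !andbT => -[[s0 t0] st]; exists (s p), (t p);
    split => //.
  apply: injective_projections; rewrite /= /GRing.scale /= /s /t /dt; field;
    exact: nd.
rewrite -[_ @^-1` _]setTI -[t @^-1` _]setTI -[(s \+ t) @^-1` _]setTI.
apply: measurableI; first apply: measurableI.
- exact: ms.
- exact: mt.
- exact: measurable_funD.
Qed.

Lemma polygon_measurable (R : realType) (S : set (R * R)) :
  polygon S -> measurable (S : set (plane R)).
Proof.
move=> [_ [n [a [b [c [nd ->]]]]]].
by apply: countable_bigcupT_measurable => // k; exact: triangle_measurable.
Qed.

Lemma polygon_bounded (R : realType) (S : set (R * R)) :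
  polygon S -> exists M : R, forall p, S p -> `|p.1| <= M /\ `|p.2| <= M.
Proof.
move=> [_ [n [a [b [c [_ ->]]]]]].
pose m (x y z : R) := `|x| + `|y - x| + `|z - x|.
have mE (x y z s t : R) : 0 <= s -> 0 <= t -> s + t <= 1 ->
    `|x + s * (y - x) + t * (z - x)| <= m x y z.
  move=> s0 t0 st; rewrite (le_trans (ler_normD _ _))// lerD//.
    rewrite (le_trans (ler_normD _ _))// lerD// normrM ger0_norm//.
    by rewrite ler_piMl//; lra.
  by rewrite normrM ger0_norm// ler_piMl//; lra.
have m0 x y z : 0 <= m x y z by rewrite !addr_ge0.
pose mk k := m (a k).1 (b k).1 (c k).1 + m (a k).2 (b k).2 (c k).2.
have mk0 k : 0 <= mk k by rewrite addr_ge0.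
exists (\sum_k mk k) => p [k _ [s [t [s0 t0 st ->]]]].
have kle : mk k <= \sum_j mk j by rewrite (bigD1 k)//= lerDl sumr_ge0.
by split; apply: le_trans kle; apply: (le_trans (mE _ _ _ _ _ s0 t0 st));
  rewrite ?lerDl ?lerDr.
Qed.

Lemma polygon_finite (R : realType) (S : set (R * R)) :
  polygon S -> (lebesgue2 R (S : set (plane R)) < +oo)%E.
Proof.
move=> pS; have [M hM] := polygon_bounded pS.
pose I : set (measurableTypeR R) := `[- M, M]%classic.
have mI : measurable I by exact: measurable_itv.
apply: (@le_lt_trans _ _ (lebesgue2 R (I `*` I))).
  apply: le_measure; rewrite ?inE;
    [exact: polygon_measurable|exact: measurableX|].
  by move=> p /hM [h1 h2]; split; rewrite /I /= in_itv /= -ler_norml.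
have -> : lebesgue2 R (I `*` I) = (lebesgue_measure I * lebesgue_measure I)%E.
  exact: product_measure1E.
by rewrite lebesgue_measure_itv /=; case: ifP => _;
  rewrite -?EFinB -?EFinM ltry.
Qed.

(** The padded polygon sits in a compact cube, on which the continuous factor from
    [continuous_chart_factor] is bounded. *)
Lemma continuous_polygon_bounded (R : realType) (f : 'rV[R]_3 -> R)
    (o t1 t2 : 'rV[R]_3) (S : set (R * R)) :
  polygon S -> continuous f ->
  exists2 C : R, 0 <= C & forall p, S p -> `|f (plane_chart o t1 t2 p)| <= C.
Proof.
move=> pS cf; have [M hM] := polygon_bounded pS.
have [g cg fg] := continuous_chart_factor o t1 t2 cf.
pose K := [set v : 'rV[R]_3 | forall k, `[- M, M]%classic (v ord0 k)].
have cK : compact K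
  by exact: (@rV_compact R 3 (fun=> `[- M, M]%classic) (fun=> @segment_compact
    R _ _)).
have : compact (g @` K) by apply: continuous_compact => //;
  exact: continuous_subspaceT.
move=> /compact_bounded /pinfty_ex_gt0[C C0 hC]; exists C => [|p Sp];
  first exact: ltW.
have [h1 h2] := hM _ Sp; have M0 : 0 <= M by exact: le_trans h1.
rewrite fg; apply: hC => /=; exists (vec3 (p, 0)) => // k /=.
by rewrite in_itv /= -ler_norml vec3E; case: k => [[|[|[|//]]] ?] /=;
  rewrite ?normr0.
Qed.

(** * Integrals and Frobenius products *)

(* No integrability is needed: when both parts of [f] have infinite integral,
   both sides are the junk value [fine -oo = 0]. *)
Lemma fine_integralN d (T : measurableType d) (R : realType)
    (mu : {measure set T -> \bar R}) (D : set T) (f : T -> R) :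
  fine (\int[mu]_(x in D) (- f x)%:E)%E = - fine (\int[mu]_(x in D) (f x)%:E)%E.
Proof.
rewrite integralE [in RHS]integralE.
have -> : (fun x => (- f x)%:E)^\+%E = (fun x => (f x)%:E)^\-%E
  by rewrite -funeposN.
have -> : (fun x => (- f x)%:E)^\-%E = (fun x => (f x)%:E)^\+%E
  by rewrite -funenegN.
by case: (integral _ _ _) => [a||]; case: (integral _ _ _) => [b||] //=;
  rewrite ?oppr0 ?opprB.
Qed.

Lemma fine_integral_lin d (T : measurableType d) (R : realType)
    (mu : {measure set T -> \bar R}) (D : set T) (f g : T -> R) (a : R) :
  measurable D ->
  mu.-integrable D (EFin \o f) -> mu.-integrable D (EFin \o g) ->
  fine (\int[mu]_(x in D) (a * f x + g x)%:E)%E =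
  a * fine (\int[mu]_(x in D) (f x)%:E)%E + fine (\int[mu]_(x in D) (g x)%:E)%E.
Proof.
move=> mD fi gi.
have afi : mu.-integrable D (fun x => a%:E * (EFin \o f) x)%E
  by exact: integrableZl.
have -> : (\int[mu]_(x in D) (a * f x + g x)%:E =
    a%:E * \int[mu]_(x in D) (f x)%:E + \int[mu]_(x in D) (g x)%:E)%E.
  by rewrite -(integralZl mD fi) -(integralD mD afi gi); apply: eq_integral.
have f1 : (\int[mu]_(x in D) (f x)%:E)%E \is a fin_num
  by exact: (integrable_fin_num mD fi).
have g1 : (\int[mu]_(x in D) (g x)%:E)%E \is a fin_num
  by exact: (integrable_fin_num mD gi).
by rewrite fineD ?fineM// fin_numM.
Qed.

(** The product is dominated by [f ^+ 2 + g ^+ 2]. *)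
Lemma sq_integrable_mul d (T : measurableType d) (R : realType)
    (mu : {measure set T -> \bar R}) (D : set T) (f g : T -> R) :
  measurable D -> measurable_fun D f -> measurable_fun D g ->
  (\int[mu]_(x in D) (f x ^+ 2)%:E < +oo)%E ->
  (\int[mu]_(x in D) (g x ^+ 2)%:E < +oo)%E ->
  mu.-integrable D (EFin \o (fun x => f x * g x)).
Proof.
move=> mD mf mg fi gi.
have sqi (h : T -> R) : measurable_fun D h ->
    (\int[mu]_(x in D) (h x ^+ 2)%:E < +oo)%E ->
    mu.-integrable D (EFin \o (fun x => h x ^+ 2)).
  move=> mh hi; apply/integrableP; split.
    by apply/measurable_EFinP; exact: measurable_funX.
  apply: le_lt_trans hi; rewrite le_eqVlt; apply/orP; left; apply/eqP.
  by apply: eq_integral => x _; rewrite /= ger0_norm// sqr_ge0.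
apply: (le_integrable mD _ _ (integrableD mD (sqi _ mf fi) (sqi _ mg gi))).
  by apply/measurable_EFinP; exact: measurable_funM.
move=> x _ /=; rewrite lee_fin normrM [leRHS]ger0_norm ?addr_ge0 ?sqr_ge0//.
rewrite -(real_normK (num_real (f x))) -(real_normK (num_real (g x))) !expr2.
have := normr_ge0 (f x); have := normr_ge0 (g x); nra.
Qed.

(** A finite integral of the majorant makes [f] integrable, so neither [fine] falls back on its
    default value. *)
Lemma le_fine_integral d (T : measurableType d) (R : realType)
    (mu : {measure set T -> \bar R}) (D : set T) (f h : T -> R) :
  measurable D -> measurable_fun D f -> measurable_fun D h ->
  (forall x, D x -> `|f x| <= h x) ->
  (\int[mu]_(x in D) (h x)%:E < +oo)%E ->
  `|fine (\int[mu]_(x in D) (f x)%:E)%E| <= fine (\int[mu]_(x in D) (h x)%:E)%E.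
Proof.
move=> mD mf mh fh hi.
have mEf : measurable_fun D (EFin \o f) by exact/measurable_EFinP.
have mEh : measurable_fun D (EFin \o h) by exact/measurable_EFinP.
have h0 x : D x -> 0 <= h x by move=> /fh; exact: le_trans.
have le1 : (\int[mu]_(x in D) `|(EFin \o f) x| <= \int[mu]_(x in D) (h x)%:E)%E.
  apply: ge0_le_integral => //=.
  by apply/measurable_EFinP; apply: measurableT_comp.
have fi : mu.-integrable D (EFin \o f).
  by apply/integrableP; split => //; exact: le_lt_trans hi.
have f1 := integrable_fin_num mD fi.
have h1 : (\int[mu]_(x in D) (h x)%:E)%E \is a fin_num.
  by rewrite ge0_fin_numE//; apply: integral_ge0 => x /h0; rewrite lee_fin.
rewrite -lee_fin fineK// -fine_abse// fineK ?abse_fin_num//.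
exact: le_trans (le_abse_integral mu mD mEf) le1.
Qed.

Lemma ddotE (R : realType) (n : nat) (u v : 'rV[R]_n) :
  ddot u v = \sum_k u 0 k * v 0 k.
Proof. by rewrite /ddot big_ord1. Qed.

Lemma ddotNr (R : realType) (m n : nat) (A B : 'M[R]_(m, n)) :
  ddot A (- B) = - ddot A B.
Proof.
rewrite /ddot -sumrN; apply: eq_bigr => i _; rewrite -sumrN.
by apply: eq_bigr => j _; rewrite mxE mulrN.
Qed.

Lemma ddotC (R : realType) (m n : nat) (A B : 'M[R]_(m, n)) :
  ddot A B = ddot B A.
Proof. by apply: eq_bigr => i _; apply: eq_bigr => j _; rewrite mulrC. Qed.

Lemma ddot_linl (R : realType) (m n : nat) (a : R) (A A' B : 'M[R]_(m, n)) :
  ddot (a *: A + A') B = a * ddot A B + ddot A' B.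
Proof.
rewrite /ddot mulr_sumr -big_split; apply: eq_bigr => i _ /=.
rewrite mulr_sumr -big_split; apply: eq_bigr => j _ /=.
by rewrite !mxE mulrDl mulrA.
Qed.

Lemma ddot_ge0 (R : realType) (m n : nat) (A : 'M[R]_(m, n)) : 0 <= ddot A A.
Proof. by apply: sumr_ge0 => i _; apply: sumr_ge0 => j _;
  rewrite -expr2 sqr_ge0. Qed.

Lemma ddot_entry (R : realType) (m n : nat) (A : 'M[R]_(m, n)) i j :
  A i j ^+ 2 <= ddot A A.
Proof.
rewrite /ddot (bigD1 i)//= (bigD1 j)//= -expr2 -addrA lerDl addr_ge0//.
  by apply: sumr_ge0 => l _; rewrite -expr2 sqr_ge0.
by apply: sumr_ge0 => k _; apply: sumr_ge0 => l _; rewrite -expr2 sqr_ge0.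
Qed.

(* AM-GM in each entry. *)
Lemma ddot_le (R : realType) (m n : nat) (A B : 'M[R]_(m, n)) (t : R) :
  0 < t -> `|ddot A B| <= t / 2 * ddot A A + (2 * t)^-1 * ddot B B.
Proof.
move=> t0; rewrite /ddot !mulr_sumr -big_split (le_trans (ler_norm_sum _ _
  _))//.
apply: ler_sum => i _ /=; rewrite !mulr_sumr -big_split.
rewrite (le_trans (ler_norm_sum _ _ _))//; apply: ler_sum => j _ /=.
set x := A i j; set y := B i j.
have -> : t / 2 * (x * x) + (2 * t)^-1 * (y * y) =
  (2 * t)^-1 * ((t * x) ^+ 2 + y ^+ 2).
  by field; rewrite gt_eqF.
have -> : `|x * y| = (2 * t)^-1 * (2 * (`|t * x| * `|y|)).
  by rewrite !normrM (gtr0_norm t0); field; rewrite gt_eqF.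
apply: ler_wpM2l; first by rewrite invr_ge0 mulr_ge0 ?ltW.
rewrite -(real_normK (num_real (t * x))) -(real_normK (num_real y)).
rewrite -subr_ge0; set a := `|t * x|; set b := `|y|.
have -> : a ^+ 2 + b ^+ 2 - 2 * (a * b) = (a - b) ^+ 2 by ring.
exact: sqr_ge0.
Qed.

(** A symmetric matrix pairs equally with [B] and its transpose. Symmetry of [hess phi] is not among
    the data of [H2_0D], so it is the symmetry of the tensor field that allows [eps] to be
    dropped. *)
Lemma ddot_eps (R : realType) (A B : 'M[R]_3) :
  A^T = A -> ddot A (eps B) = ddot A B.
Proof.
move=> At; have e : ddot A B^T = ddot A B.
  rewrite /ddot exchange_big; apply: eq_bigr => i _; apply: eq_bigr => j _ /=.
  by rewrite mxE -{1}At mxE.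
rewrite ddotC /eps scalerDr ddot_linl.
have -> : ddot (2^-1 *: B^T) A = 2^-1 * ddot B^T A + ddot (0 : 'M[R]_3) A.
  by rewrite -ddot_linl addr0.
rewrite [ddot 0 A]big1 ?addr0; last first.
  by move=> i _; rewrite big1// => j _; rewrite mxE mul0r.
by rewrite ![ddot _ A]ddotC e; field.
Qed.

(** * Sobolev functions and traces *)

(** The entrywise form includes measurability, which finiteness of [L2sq] alone would not give. *)
Definition L2mx (R : realType) (Om : set 'rV[R]_3) (m n : nat)
    (F : 'rV[R]_3 -> 'M[R]_(m, n)) : Prop :=
  forall i j, L2 Om (fun x => F x i j).

Lemma L2sq_ge0 (R : realType) (Om : set 'rV[R]_3) (m n : nat)
    (F : 'rV[R]_3 -> 'M[R]_(m, n)) : (0 <= L2sq Om F)%E.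
Proof. by apply: integral_ge0 => p _; rewrite lee_fin ddot_ge0. Qed.

Lemma ddot_integrable (R : realType) (Om : set 'rV[R]_3) (m n : nat)
    (F G : 'rV[R]_3 -> 'M[R]_(m, n)) :
  open Om -> L2mx Om F -> L2mx Om G ->
  (lebesgue3 R).-integrable (@vec3 R @^-1` Om)
    (EFin \o (fun p => ddot (F (vec3 p)) (G (vec3 p)))).
Proof.
move=> oO hF hG; have mO := open_vec3_measurable oO.
have -> : EFin \o (fun p => ddot (F (vec3 p)) (G (vec3 p))) =
    (fun p => \sum_i \sum_j (F (vec3 p) i j * G (vec3 p) i j)%:E)%E.
  by apply/funext => p; rewrite /= /ddot -sumEFin; apply: eq_bigr => i _;
    rewrite -sumEFin.
apply: integrable_sum => // i _; apply: integrable_sum => // j _.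
have [mF F2] := hF i j; have [mG G2] := hG i j.
exact: (sq_integrable_mul mO mF mG).
Qed.

Lemma L2mx_fin (R : realType) (Om : set 'rV[R]_3) (m n : nat)
    (F : 'rV[R]_3 -> 'M[R]_(m, n)) :
  open Om -> L2mx Om F -> L2sq Om F \is a fin_num.
Proof.
move=> oO hF; have := ddot_integrable oO hF hF.
by move/integrable_fin_num; apply; exact: open_vec3_measurable.
Qed.

Lemma ddot_measurable (R : realType) (Om : set 'rV[R]_3) (m n : nat)
    (F G : 'rV[R]_3 -> 'M[R]_(m, n)) :
  L2mx Om F -> L2mx Om G ->
  measurable_fun (@vec3 R @^-1` Om) (fun p => ddot (F (vec3 p)) (G (vec3 p))).
Proof.
move=> hF hG; apply: measurable_sum => i; apply: measurable_sum => j.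
by apply: measurable_funM; [exact: (hF i j).1|exact: (hG i j).1].
Qed.

(** This is [ddot_le] integrated. The weight stays free so that it can be shared with the estimate
    of the gradient term. *)
Lemma vintR_ddot_le (R : realType) (Om : set 'rV[R]_3) (m n : nat)
    (F G : 'rV[R]_3 -> 'M[R]_(m, n)) (t : R) :
  open Om -> L2mx Om F -> L2mx Om G -> 0 < t ->
  `|vintR Om (fun x => ddot (F x) (G x))| <=
    t / 2 * fine (L2sq Om F) + (2 * t)^-1 * fine (L2sq Om G).
Proof.
move=> oO hF hG t0; have mO := open_vec3_measurable oO.
have iF := ddot_integrable oO hF hF.
have iG := ddot_integrable oO hG hG.
have iG' : (lebesgue3 R).-integrable (@vec3 R @^-1` Om)
    (EFin \o (fun p => (2 * t)^-1 * ddot (G (vec3 p)) (G (vec3 p)))).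
  exact: (integrableZl mO (2 * t)^-1 iG).
pose h p := t / 2 * ddot (F (vec3 p)) (F (vec3 p)) +
  (2 * t)^-1 * ddot (G (vec3 p)) (G (vec3 p)).
have ih : (lebesgue3 R).-integrable (@vec3 R @^-1` Om) (EFin \o h).
  exact: (integrableD mO (integrableZl mO (t / 2) iF) iG').
have := @le_fine_integral _ _ _ (lebesgue3 R) (@vec3 R @^-1` Om)
  (fun p => ddot (F (vec3 p)) (G (vec3 p))) h mO.
rewrite fine_integral_lin//.
have -> : fine (\int[lebesgue3 R]_(x in @vec3 R @^-1` Om)
    ((2 * t)^-1 * ddot (G (vec3 x)) (G (vec3 x)))%:E)%E =
      (2 * t)^-1 * fine (L2sq Om G).
  under eq_integral do rewrite EFinM.
  by rewrite (integralZl mO iG) fineM// ; exact: (integrable_fin_num mO iG).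
apply.
- exact: ddot_measurable.
- by case/integrableP: ih => /measurable_EFinP.
- by move=> p _; exact: ddot_le.
- exact: (integrable_lty mO ih).
Qed.

Lemma smooth_continuous (R : realType) (f : 'rV[R]_3 -> R) :
  smooth f -> continuous f.
Proof. by move=> /(_ 0%N). Qed.

Lemma Cn_lin (R : realType) (n : nat) (f g : 'rV[R]_3 -> R) (a : R) :
  Cn n f -> Cn n g -> Cn n (fun x => a * f x + g x).
Proof.
have cl (u v : 'rV[R]_3 -> R) : continuous u -> continuous v ->
    continuous (fun x => a * u x + v x).
  by move=> cu cv x; apply: (cvgD (cvgM (cvg_cst a) (cu x)) (cv x)).
elim: n f g => [|n IH] f g /=; first exact: cl.
have fE : (fun x => a * f x + g x) = (a \*: f : 'rV[R]_3 -> R) + g by [].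
move=> [cf df] [cg dg]; split; first exact: cl.
move=> k; have [df1 df2] := df k; have [dg1 dg2] := dg k; split.
  by move=> x; rewrite fE; apply: derivableD; [exact: derivableZ|].
have -> : (fun x => 'D_(e_ R k) (fun x => a * f x + g x) x) =
    (fun x => a * 'D_(e_ R k) f x + 'D_(e_ R k) g x).
  apply/funext => x.
  rewrite fE deriveD//; last exact: derivableZ.
  by rewrite deriveZ.
exact: IH.
Qed.

Lemma smooth_lin (R : realType) (f g : 'rV[R]_3 -> R) (a : R) :
  smooth f -> smooth g -> smooth (fun x => a * f x + g x).
Proof. by move=> sf sg n; exact: Cn_lin. Qed.

Lemma smooth_opp (R : realType) (f : 'rV[R]_3 -> R) :
  smooth f -> smooth (fun x => - f x).
Proof.
(* Writing [- f] as [-2 * f + f] reduces negation to closure under combinations. *)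
move=> sf; have := smooth_lin (-2) sf sf.
by congr smooth; apply/funext => x; ring.
Qed.

Lemma derive_opp (R : realType) (f : 'rV[R]_3 -> R) k x :
  smooth f -> 'D_(e_ R k) (fun x => - f x) x = - 'D_(e_ R k) f x.
Proof.
move=> /(_ 1%N) [_ /(_ k) [df _]].
by rewrite (_ : (fun x => - f x) = - f)// deriveN.
Qed.

Lemma L2_opp (R : realType) (Om : set 'rV[R]_3) (f : 'rV[R]_3 -> R) :
  L2 Om f -> L2 Om (fun x => - f x).
Proof.
move=> [mf f2]; split; first exact: measurable_funN.
by rewrite /vint; under eq_integral do rewrite sqrrN.
Qed.

Lemma H1_opp (R : realType) (Om : set 'rV[R]_3)
    (u : 'rV[R]_3 -> R) (G : 'rV[R]_3 -> 'rV[R]_3) :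
  H1 Om u G -> H1 Om (fun x => - u x) (fun x => - G x).
Proof.
have GN k : (fun x => (- G x) 0 k) = (fun x => - G x 0 k)
  by apply/funext => x; rewrite mxE.
move=> [u2 G2 wd]; split => [|k|k psi tpsi]; first exact: L2_opp.
  by rewrite GN; exact: L2_opp.
rewrite /vintR /vint; under eq_integral do rewrite mulNr.
rewrite fine_integralN [X in - X](wd k psi tpsi).
congr (- _); rewrite -fine_integralN; congr fine.
by apply: eq_integral => p _; rewrite mxE mulNr.
Qed.

Lemma trace_opp (R : realType) (P : polyhedral_domain R)
    (u : 'rV[R]_3 -> R) (G : 'rV[R]_3 -> 'rV[R]_3) (b : 'rV[R]_3 -> R) :
  Defs.trace P u G b ->
  Defs.trace P (fun x => - u x) (fun x => - G x) (fun x => - b x).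
Proof.
move=> [h hb [v [sv lim1 lim2]]]; split; first exact: H1_opp.
  move=> i; have [mb b2] := hb i; split; first exact: measurable_funN.
  by rewrite /fint; under eq_integral do rewrite sqrrN.
have sqNN (x y : R) : (- x - - y) ^+ 2 = (x - y) ^+ 2 by rewrite -opprD sqrrN.
exists (fun n x => - v n x); split => [n||].
- exact: smooth_opp.
- move: lim1; apply: cvg_trans; apply: near_eq_cvg; apply: nearW => n;
  congr (_ + _)%E.
    by apply: eq_integral => p _; rewrite sqNN.
  apply: eq_bigr => k _; apply: eq_integral => p _.
  by rewrite derive_opp// mxE sqNN.
- move: lim2; apply: cvg_trans; apply: near_eq_cvg; apply: nearW => n.
  by apply: eq_bigr => i _; apply: eq_integral => p _; rewrite sqNN.
Qed.

(** Serves to turn the one-sided bound by the supremum in [normdd] into a bound on the absolute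
    value. *)
Lemma H2_0D_opp (R : realType) (P : polyhedral_domain R) (D : set (faces P))
    (phi : H2_0D D) :
  exists phi' : H2_0D D,
    [/\ grad phi' = (fun x => - grad phi x), hess phi' = (fun x => - hess phi x)
      & gtr phi' = (fun x => - gtr phi x)].
Proof.
have rowN k : (fun x => row k (- hess phi x)) = (fun x => - row k (hess phi x)).
  by apply/funext => x; apply/rowP => j; rewrite !mxE.
have entN (F : 'rV[R]_3 -> 'rV[R]_3) k :
  (fun x => (- F x) 0 k) = (fun x => - F x 0 k).
  by apply/funext => x; rewrite mxE.
have gH k : H1 (dom P) (fun x => (- grad phi x) 0 k) (fun x => row k (- hess
  phi x)).
  by rewrite rowN entN; apply: H1_opp; exact: grad_H1.
have fD : exists2 b, Defs.trace P (fun x => - fn phi x) (fun x => - grad phi x)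
  b &
    forall i, D i -> ae_face i (fun x => b x = 0).
  have [b tb b0] := fn_D phi; exists (fun x => - b x); first exact: trace_opp.
  move=> i /b0; rewrite /ae_face; apply: filterS => p h /h ->.
  by rewrite oppr0.
have gT k : Defs.trace P (fun x => (- grad phi x) 0 k) (fun x => row k (- hess
  phi x))
    (fun x => (- gtr phi x) 0 k).
  by rewrite rowN !entN; apply: trace_opp; exact: gtr_trace.
by exists (MkH2_0D (H1_opp (fn_H1 phi)) gH fD gT).
Qed.

Lemma grad_L2mx (R : realType) (P : polyhedral_domain R) (D : set (faces P))
    (phi : H2_0D D) : L2mx (dom P) (grad phi).
Proof. by move=> i k; rewrite (ord1 i); have [_ h _] := fn_H1 phi;
  exact: h. Qed.

Lemma hess_L2mx (R : realType) (P : polyhedral_domain R) (D : set (faces P))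
    (phi : H2_0D D) : L2mx (dom P) (hess phi).
Proof.
move=> i j; have [_ /(_ j)] := grad_H1 phi i.
have -> // : (fun x => row i (hess phi x) 0 j) = (fun x => hess phi x i j).
by apply/funext => x; rewrite mxE.
Qed.

Lemma continuous_sum (T : topologicalType) (R : realType) (I : finType)
    (f : I -> T -> R) :
  (forall i, continuous (f i)) -> continuous (fun x => \sum_i f i x).
Proof.
move=> cf x; apply: cvg_big => [|i _]; [exact: add_continuous|exact: cf].
Qed.

Lemma nn_continuous (R : realType) (P : polyhedral_domain R) (i : faces P)
    (tau : 'rV[R]_3 -> 'M[R]_3) :
  (forall k l, continuous (fun x => tau x k l)) -> continuous (nn tau i).
Proof.
move=> ct.
have -> : nn tau i =
  fun x => \sum_j fnormal i 0 j * \sum_l fnormal i 0 l * tau x j l.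
  apply/funext => x; rewrite /nn mxE; apply: eq_bigr => j _; congr (_ * _).
  by rewrite mxE; apply: eq_bigr => l _; rewrite mulrC mxE.
have cM c (g : 'rV[R]_3 -> R) : continuous g -> continuous (fun x => c * g x).
  by move=> cg x; exact: (cvgM (cvg_cst c) (cg x)).
apply: continuous_sum => j; apply: (cM (fnormal i 0 j)).
by apply: continuous_sum => l; apply: (cM (fnormal i 0 l)).
Qed.

Lemma dn_measurable (R : realType) (P : polyhedral_domain R) (D : set (faces P))
    (phi : H2_0D D) (i : faces P) : face_measurable i (dn phi i).
Proof.
rewrite /face_measurable.
have -> : dn phi i \o fchart i =
    fun p => \sum_k gtr phi (fchart i p) 0 k * fnormal i 0 k.
  by apply/funext => p; rewrite /= /dn ddotE.
apply: measurable_sum => k; apply: measurable_funM => //.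
by have [_ /(_ i) [mg _] _] := gtr_trace phi k.
Qed.

(** The factor [nn tau i] is bounded on a polygon of finite area, hence square integrable there, and
    each component of [gtr phi] is square integrable as part of being a trace. *)
Lemma nn_dn_integrable (R : realType) (P : polyhedral_domain R)
    (D : set (faces P)) (phi : H2_0D D) (i : faces P)
    (tau : 'rV[R]_3 -> 'M[R]_3) :
  (forall k l, continuous (fun x => tau x k l)) ->
  (lebesgue2 R).-integrable (fpoly i : set (plane R))
    (EFin \o (fun p => nn tau i (fchart i p) * dn phi i (fchart i p))).
Proof.
move=> /(nn_continuous (i := i)) ct; have pS := fpoly_polygon i.
have mS := polygon_measurable pS.
have [C C0 hC] := continuous_polygon_bounded (forigin i) (ftan1 i) (ftan2 i) pS
  ct.
have -> : EFin \o (fun p => nn tau i (fchart i p) * dn phi i (fchart i p)) =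
    (fun p => \sum_k (nn tau i (fchart i p) * fnormal i 0 k * gtr phi (fchart i
      p) 0 k)%:E)%E.
  apply/funext => p; rewrite /= /dn ddotE mulr_sumr -sumEFin;
    apply: eq_bigr => k _.
  by congr EFin; ring.
apply: integrable_sum => // k _.
have [_ /(_ i) [mg g2] _] := gtr_trace phi k.
have mn : measurable_fun (fpoly i :
  set (plane R)) (fun p => nn tau i (fchart i p) * fnormal i 0 k).
  by apply: measurable_funM => //; exact: continuous_chart_measurable.
apply: (sq_integrable_mul mS mn mg _ g2).
apply: (integrable_lty mS).
apply: measurable_bounded_integrable => //;
  [exact: polygon_finite|exact: measurable_funX|].
exists ((C * `|fnormal i 0 k|) ^+ 2); split; first exact: num_real.
move=> M hM p Sp /=; apply: le_trans (ltW hM).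
rewrite normrX normrM; apply: lerXn2r; rewrite ?nnegrE ?mulr_ge0//.
by apply: ler_wpM2r => //; exact: hC.
Qed.

(** * The norm of H(div div) *)

(** When [y] is 0 the quotient is [x] times +oo, so a finite bound forces [x <= 0]: the value of 0 /
    0 hides no failure of the estimate. *)
Lemma le_of_ratio (R : realType) (x y S : R) :
  0 <= y -> (x%:E / y%:E <= S%:E)%E -> x <= S * y.
Proof.
rewrite le_eqVlt => /orP[/eqP <-|y0].
  rewrite inver eqxx mulr0 => h; rewrite leNgt; apply/negP => x0; move: h.
  by rewrite gt0_muley ?lte_fin// leye_eq.
by rewrite inver gt_eqF// lee_pdivrMr// -EFinM lee_fin.
Qed.

(** When [y] is 0 the quotient is 0 or -oo; [0 <= S] covers the first value. *)
Lemma ratio_le (R : realType) (x y S : R) :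
  0 <= y -> 0 <= S -> x <= S * y -> (x%:E / y%:E <= S%:E)%E.
Proof.
move=> + S0; rewrite le_eqVlt => /orP[/eqP <-|y0].
  rewrite mulr0 inver eqxx le_eqVlt => /orP[/eqP ->|x0];
    first by rewrite mul0e lee_fin.
  by rewrite lt0_muley ?lte_fin// leNye.
by rewrite inver gt_eqF// lee_pdivrMr// -EFinM lee_fin.
Qed.

Lemma smooth_L2mx (R : realType) (Om : set 'rV[R]_3) (m n : nat)
    (F : 'rV[R]_3 -> 'M[R]_(m, n)) :
  open Om -> (forall i j, continuous (fun x => F x i j)) ->
  (L2sq Om F < +oo)%E -> L2mx Om F.
Proof.
move=> oO cF F2 i j; have mO := open_vec3_measurable oO.
have mF k l : measurable_fun (@vec3 R @^-1` Om) (fun p => F (vec3 p) k l).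
  exact: continuous_vec3_measurable (cF k l).
split; first exact: mF.
apply: le_lt_trans F2; apply: ge0_le_integral => //.
- by move=> p _; rewrite lee_fin sqr_ge0.
- by apply/measurable_EFinP; apply: measurable_funX; exact: mF.
- apply/measurable_EFinP; apply: measurable_sum => k;
  apply: measurable_sum => l.
  by apply: measurable_funM; exact: mF.
- by move=> p _; rewrite lee_fin ddot_entry.
Qed.

Lemma L2sq_lin_lty (R : realType) (Om : set 'rV[R]_3) (m n : nat)
    (F G : 'rV[R]_3 -> 'M[R]_(m, n)) (a : R) :
  open Om -> L2mx Om F -> L2mx Om G ->
  (L2sq Om (fun x => a *: F x + G x)%R < +oo)%E.
Proof.
move=> oO hF hG; have mO := open_vec3_measurable oO.
have iFF := ddot_integrable oO hF hF.
have iFG := ddot_integrable oO hF hG.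
have iGG := ddot_integrable oO hG hG.
have := integrable_lty mO (integrableD mO (integrableD mO (integrableZl mO (a
  ^+ 2) iFF)
  (integrableZl mO (2 * a) iFG)) iGG).
apply: le_lt_trans; rewrite le_eqVlt; apply/orP; left; apply/eqP.
apply: eq_integral => p _ /=; rewrite -!EFinM -!EFinD; congr EFin.
by rewrite !(ddot_linl, ddotC _ (_ + _)) (ddotC (G _) (F _)); ring.
Qed.

Lemma divdivE (R : realType) (P : polyhedral_domain R) (D : set (faces P))
    (tau : 'rV[R]_3 -> 'M[R]_3) (phi : H2_0D D) :
  (forall x, (tau x)^T = tau x) ->
  divdiv tau phi = vintR (dom P) (fun x => ddot (tau x) (hess phi x)) -
    \sum_i fintR i (fun x => nn tau i x * dn phi i x).
Proof.
move=> st; congr (_ - _); congr fine; apply: eq_integral => p _.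
by rewrite ddot_eps.
Qed.

Lemma divdiv_opp (R : realType) (P : polyhedral_domain R) (D : set (faces P))
    (tau : 'rV[R]_3 -> 'M[R]_3) (phi : H2_0D D) :
  (forall x, (tau x)^T = tau x) ->
  exists2 phi' : H2_0D D, grad phi' = (fun x => - grad phi x) &
    divdiv tau phi' = - divdiv tau phi.
Proof.
move=> st; have [phi' [gE hE tE]] := H2_0D_opp phi; exists phi' => //.
rewrite !divdivE// opprB addrC -sumrN; congr (_ + _).
  apply: eq_bigr => i _; rewrite -fine_integralN; congr fine.
  by apply: eq_integral => p _; rewrite /dn tE ddotC ddotNr ddotC mulrN opprK.
rewrite -fine_integralN; congr fine.
by apply: eq_integral => p _; rewrite hE ddotNr.
Qed.

Lemma L2norm_opp (R : realType) (Om : set 'rV[R]_3) (m n : nat)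
    (F : 'rV[R]_3 -> 'M[R]_(m, n)) :
  L2norm Om (fun x => - F x) = L2norm Om F.
Proof.
congr sqrte; apply: eq_integral => p _.
by rewrite ddotNr ddotC ddotNr opprK.
Qed.

Lemma L2normE (R : realType) (Om : set 'rV[R]_3) (m n : nat)
    (F : 'rV[R]_3 -> 'M[R]_(m, n)) :
  open Om -> L2mx Om F -> L2norm Om F = (Num.sqrt (fine (L2sq Om F)))%:E.
Proof. by move=> oO hF; rewrite /L2norm -[in LHS](fineK (L2mx_fin oO hF)). Qed.

Lemma nn_lin (R : realType) (P : polyhedral_domain R) (i : faces P)
    (tau sigma : 'rV[R]_3 -> 'M[R]_3) (a : R) x :
  nn (fun x => a *: tau x + sigma x) i x = a * nn tau i x + nn sigma i x.
Proof.
by rewrite /nn mulmxDl mulmxDr -scalemxAl -scalemxAr mxE [X in X + _]mxE.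
Qed.

Lemma fintR_nn_dn_lin (R : realType) (P : polyhedral_domain R)
    (D : set (faces P)) (phi : H2_0D D) (i : faces P)
    (tau sigma : 'rV[R]_3 -> 'M[R]_3) (a : R) :
  (forall k l, continuous (fun x => tau x k l)) ->
  (forall k l, continuous (fun x => sigma x k l)) ->
  fintR i (fun x => nn (fun x => a *: tau x + sigma x) i x * dn phi i x) =
  a * fintR i (fun x => nn tau i x * dn phi i x) +
  fintR i (fun x => nn sigma i x * dn phi i x).
Proof.
move=> ct cs; have mS := polygon_measurable (fpoly_polygon i).
have := fine_integral_lin a mS (nn_dn_integrable phi i ct) (nn_dn_integrable
  phi i cs).
move=> <-; congr fine; apply: eq_integral => p _.
by rewrite nn_lin mulrDl mulrA.
Qed.

Lemma divdiv_lin (R : realType) (P : polyhedral_domain R) (D : set (faces P))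
    (tau sigma : 'rV[R]_3 -> 'M[R]_3) (a : R) (phi : H2_0D D) :
  (forall k l, continuous (fun x => tau x k l)) ->
  (forall k l, continuous (fun x => sigma x k l)) ->
  (forall x, (tau x)^T = tau x) -> (forall x, (sigma x)^T = sigma x) ->
  L2mx (dom P) tau -> L2mx (dom P) sigma ->
  divdiv (fun x => a *: tau x + sigma x) phi =
  a * divdiv tau phi + divdiv sigma phi.
Proof.
move=> ct cs st ss t2 s2.
have oO := @dom_open _ P; have mO := open_vec3_measurable oO.
have h2 := hess_L2mx phi.
rewrite !divdivE//; last by move=> x; rewrite linearD/= linearZ/= st ss.
rewrite mulrBr addrACA; congr (_ + _).
  rewrite -(fine_integral_lin a mO (ddot_integrable oO t2 h2) (ddot_integrable
    oO s2 h2)).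
  by congr fine; apply: eq_integral => p _; rewrite ddot_linl.
rewrite -opprD; congr (- _); rewrite mulr_sumr -big_split.
by apply: eq_bigr => i _; exact: fintR_nn_dn_lin.
Qed.

Lemma normddP (R : realType) (P : polyhedral_domain R) (D : set (faces P))
    (tau : 'rV[R]_3 -> 'M[R]_3) :
  smooth_Hdd D tau ->
  exists S : R,
  [/\ L2mx (dom P) tau,
      normdd D tau = (Num.sqrt (fine (L2sq (dom P) tau) + S ^+ 2))%:E,
      forall phi : H2_0D D, `|divdiv tau phi| <=
        S * Num.sqrt (fine (L2sq (dom P) (grad phi))) &
      exists phi : H2_0D D, True].
Proof.
move=> [sm st]; rewrite /normdd; set s := ereal_sup _ => fin.
have A0 := L2sq_ge0 (dom P) tau.
have oO := @dom_open _ P.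
have fin2 : (L2sq (dom P) tau + s ^+ 2 < +oo)%E.
  by move: fin; case: (_ + _)%E => [r||] //= _; rewrite ?ltry ?ltNyy.
have Afin : (L2sq (dom P) tau < +oo)%E by apply: le_lt_trans fin2;
  rewrite leeDl// sqre_ge0.
have sfin : (s ^+ 2 < +oo)%E by apply: le_lt_trans fin2; rewrite leeDr.
have AE : (fine (L2sq (dom P) tau))%:E = L2sq (dom P) tau
  by rewrite fineK// ge0_fin_numE.
have hs (phi : H2_0D D) :
  ((divdiv tau phi)%:E / L2norm (dom P) (grad phi) <= s)%E.
  by apply: ereal_sup_ubound; exists phi.
(* Without admissible functions the supremum would be -oo, with square +oo, against the finiteness
   of the norm. *)
have ne : exists phi : H2_0D D, True.
  apply: contrapT => nphi; move: sfin; rewrite /s.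
  rewrite (_ : [set _ | _ in _] = set0) ?ereal_sup0 //.
  by apply/seteqP; split => // x [phi _ _]; case: nphi; exists phi.
(* Both infinite values of the supremum have square +oo, so it is a real number [S]. *)
case sE : s sfin => [S||] //= _; exists S; split => //.
- by apply: smooth_L2mx => // k l; exact: smooth_continuous.
- by rewrite -[in LHS]AE -EFinM -EFinD -expr2.
move=> phi; rewrite ler_norml lerNl; apply/andP; split.
  have [phi' gE <-] := divdiv_opp phi st.
  apply: le_of_ratio; first exact: sqrtr_ge0.
  have := hs phi'; rewrite gE L2norm_opp sE L2normE//; exact: grad_L2mx.
apply: le_of_ratio; first exact: sqrtr_ge0.
have := hs phi; rewrite sE L2normE//; exact: grad_L2mx.
Qed.

(** * The normal-normal trace *)

Lemma smooth_Hdd_lin (R : realType) (P : polyhedral_domain R)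
    (D : set (faces P)) (tau sigma : 'rV[R]_3 -> 'M[R]_3) (a : R) :
  smooth_Hdd D tau -> smooth_Hdd D sigma ->
  smooth_Hdd D (fun x => a *: tau x + sigma x).
Proof.
move=> ht hs; have [ct st _] := ht; have [cs ss _] := hs.
have [S [t2 _ tS [phi0 _]]] := normddP ht.
have [S' [s2 _ sS _]] := normddP hs.
have oO := @dom_open _ P.
split => [k l|x|].
- have -> : (fun x => (a *: tau x + sigma x) k l) =
  (fun x => a * tau x k l + sigma x k l).
    by apply/funext => x; rewrite !mxE.
  exact: smooth_lin.
- by rewrite linearD/= linearZ/= st ss.
have sqrty (x : \bar R) : (x < +oo)%E -> (sqrte x < +oo)%E.
  by case: x => [r||] //= _; rewrite ?ltry.
apply: sqrty; apply: lte_add_pinfty; first exact: L2sq_lin_lty.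
set rho := (fun x => a *: tau x + sigma x).
pose g (phi : H2_0D D) := Num.sqrt (fine (L2sq (dom P) (grad phi))).
have gE phi : L2norm (dom P) (grad phi) = (g phi)%:E.
  by rewrite L2normE//; exact: grad_L2mx.
have g0 phi : 0 <= g phi by exact: sqrtr_ge0.
pose K := `|a| * `|S| + `|S'|.
have K0 : 0 <= K by rewrite addr_ge0// mulr_ge0.
have dK phi : `|divdiv rho phi| <= K * g phi.
  rewrite divdiv_lin//; try by move=> k l; exact: smooth_continuous.
  rewrite (le_trans (ler_normD _ _))// /K mulrDl lerD//.
    rewrite normrM -mulrA; apply: ler_wpM2l => //.
    by apply: (le_trans (tS phi)); apply: ler_wpM2r => //; exact: ler_norm.
  by apply: (le_trans (sS phi)); apply: ler_wpM2r => //; exact: ler_norm.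
set s := ereal_sup _.
have sK : (s <= K%:E)%E.
  apply: ge_ereal_sup => _ [phi _ <-]; rewrite gE; apply: ratio_le => //.
  exact: le_trans (ler_norm _) (dK phi).
(* Because the supremum gets squared, it must be kept away from -oo as well; the quotient of the
   single function [phi0] does this. *)
have Ks : ((- K)%:E <= s)%E.
  apply: (@le_trans _ _ ((divdiv rho phi0)%:E / (g phi0)%:E)%E); last first.
    by rewrite -gE; apply: ereal_sup_ubound; exists phi0.
  rewrite EFinN leeNl -mulNe -EFinN; apply: ratio_le => //.
  by apply: le_trans (dK phi0); rewrite -normrN ler_norm.
by case: s sK Ks => [r||] //= _ _; rewrite -EFinM ltry.
Qed.

(** Exchanging [w] for the normal derivative of an H^2 function makes [nn_dn_integrable] applicable,
    on which additivity of the face integrals rests. *)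
Lemma fintR_has_dn (R : realType) (P : polyhedral_domain R) (D : set (faces P))
    (phi : H2_0D D) (w : 'rV[R]_3 -> R) (i : faces P)
    (tau : 'rV[R]_3 -> 'M[R]_3) :
  (forall k l, continuous (fun x => tau x k l)) ->
  face_measurable i w -> ae_face i (fun x => dn phi i x = w x) ->
  fintR i (fun x => nn tau i x * dn phi i x) = nn_functional i tau w.
Proof.
move=> ct mw dw; have mS := polygon_measurable (fpoly_polygon i).
have mn : measurable_fun (fpoly i : set (plane R)) (nn tau i \o fchart i).
  by apply: continuous_chart_measurable; exact: nn_continuous.
congr fine; apply: ae_eq_integral => //.
- by apply/measurable_EFinP; apply: measurable_funM => //; exact: dn_measurable.
- by apply/measurable_EFinP; exact: measurable_funM.
- by move: dw; rewrite /ae_face; apply: filterS => p h Sp; rewrite h.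
Qed.

Lemma nn_functional_linl (R : realType) (P : polyhedral_domain R)
    (D : set (faces P)) (i : faces P) (w : 'rV[R]_3 -> R)
    (tau sigma : 'rV[R]_3 -> 'M[R]_3) (a : R) :
  smooth_Hdd D tau -> smooth_Hdd D sigma -> Hn12 D w ->
  nn_functional i (fun x => a *: tau x + sigma x) w =
  a * nn_functional i tau w + nn_functional i sigma w.
Proof.
move=> ht hs [mw [phi dw]].
have cont rho : smooth_Hdd D rho -> forall k l, continuous (fun x => rho x k l).
  by move=> [h _ _] k l; exact: smooth_continuous.
have e rho : smooth_Hdd D rho -> nn_functional i rho w =
    fintR i (fun x => nn rho i x * dn phi i x).
  by move=> /cont ?; rewrite (fintR_has_dn (w := w)).
rewrite (e _ (smooth_Hdd_lin a ht hs)) (e _ ht) (e _ hs).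
by apply: fintR_nn_dn_lin; exact: cont.
Qed.

(** Each of [w1] and [w2] keeps its own representative, and additivity is that of the integral, so
    no representative of the combination enters. *)
Lemma nn_functional_linr (R : realType) (P : polyhedral_domain R)
    (D : set (faces P)) (i : faces P) (w1 w2 : 'rV[R]_3 -> R)
    (tau : 'rV[R]_3 -> 'M[R]_3) (a : R) :
  smooth_Hdd D tau -> Hn12 D w1 -> Hn12 D w2 ->
  nn_functional i tau (fun x => a * w1 x + w2 x) =
  a * nn_functional i tau w1 + nn_functional i tau w2.
Proof.
move=> [st _ _] [m1 [phi1 d1]] [m2 [phi2 d2]].
have ct k l : continuous (fun x => tau x k l) by exact: smooth_continuous.
have mS := polygon_measurable (fpoly_polygon i).
have mn : measurable_fun (fpoly i : set (plane R)) (nn tau i \o fchart i).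
  by apply: continuous_chart_measurable; exact: nn_continuous.
rewrite -(fintR_has_dn ct (m1 i) (d1 i)) -(fintR_has_dn ct (m2 i) (d2 i)).
have := fine_integral_lin a mS (nn_dn_integrable phi1 i ct) (nn_dn_integrable
  phi2 i ct).
move=> <-; congr fine; apply: ae_eq_integral => //.
- apply/measurable_EFinP; apply: measurable_funM => //.
  by apply: measurable_funD; [apply: measurable_funM => //;
    exact: (m1 i)|exact: (m2 i)].
- apply/measurable_EFinP; apply: measurable_funD;
  first apply: measurable_funM => //;
    by apply: measurable_funM => //; exact: dn_measurable.
- move: (d1 i) (d2 i); rewrite /ae_face; apply: filterS2 => p h1 h2 Sp.
  by rewrite h1// h2//; congr EFin; ring.
Qed.

Lemma nn_functional_divdiv (R : realType) (P : polyhedral_domain R)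
    (D : set (faces P)) (i : faces P) (w : 'rV[R]_3 -> R) (phi : H2_0D D)
    (tau : 'rV[R]_3 -> 'M[R]_3) :
  smooth_Hdd D tau -> Hn12_face D i w -> has_dn w phi ->
  nn_functional i tau w =
  vintR (dom P) (fun x => ddot (tau x) (hess phi x)) - divdiv tau phi.
Proof.
move=> [st sym _] [[mw _] w0] dw; rewrite divdivE// opprB addrC subrK.
have ct k l : continuous (fun x => tau x k l) by exact: smooth_continuous.
rewrite (bigD1 i)//= (fintR_has_dn ct (mw i) (dw i)) big1 ?addr0// => j ji.
rewrite (fintR_has_dn ct (mw j) (dw j)).
have mS := polygon_measurable (fpoly_polygon j).
have mn : measurable_fun (fpoly j : set (plane R)) (nn tau j \o fchart j).
  by apply: continuous_chart_measurable; exact: nn_continuous.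
rewrite /nn_functional /fintR /fint (ae_eq_integral (cst 0%E)) ?integral_cst
  ?mul0e//.
- by apply/measurable_EFinP; apply: measurable_funM => //; exact: (mw j).
- move: (w0 j ji); rewrite /ae_face; apply: filterS => p h Sp.
  by rewrite h// mulr0.
Qed.

Lemma Hn12_normP (R : realType) (P : polyhedral_domain R) (D : set (faces P))
    (w : 'rV[R]_3 -> R) :
  Hn12 D w -> exists2 I : R, 0 <= I & Hn12_norm D w = I%:E.
Proof.
move=> [_ [phi dw]].
have I0 : (0%R <= Hn12_norm D w)%E.
  by apply: le_ereal_inf_tmp => _ [psi _ <-]; exact: sqrte_ge0.
have If : (Hn12_norm D w < +oo)%E.
  have oO := @dom_open _ P.
  apply: (@le_lt_trans _ _ (sqrte (L2sq (dom P) (grad phi) +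
    L2sq (dom P) (hess phi)))%E).
    by apply: ereal_inf_lbound; exists phi.
  rewrite -(fineK (L2mx_fin oO (grad_L2mx phi))) -(fineK (L2mx_fin oO
    (hess_L2mx phi))).
  by rewrite -EFinD ltry.
exists (fine (Hn12_norm D w)); first exact: fine_ge0.
by rewrite fineK// ge0_fin_numE.
Qed.

Lemma nn_functional_bound (R : realType) (P : polyhedral_domain R)
    (D : set (faces P)) (i : faces P) (w : 'rV[R]_3 -> R)
    (tau : 'rV[R]_3 -> 'M[R]_3) (N I : R) :
  smooth_Hdd D tau -> Hn12_face D i w ->
  normdd D tau = N%:E -> Hn12_norm D w = I%:E ->
  `|nn_functional i tau w| <= N * I.
Proof.
move=> ht hw NE IE; have [S [t2 nE dS _]] := normddP ht.
have oO := @dom_open _ P.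
set A := fine (L2sq (dom P) tau) in nE.
have A0 : 0 <= A by apply: fine_ge0; exact: L2sq_ge0.
have N0 : 0 <= N by rewrite -lee_fin -NE nE lee_fin sqrtr_ge0.
have key (phi : H2_0D D) : has_dn w phi ->
    `|nn_functional i tau w| <= N *
      Num.sqrt (fine (L2sq (dom P) (grad phi)) +
        fine (L2sq (dom P) (hess phi))).
  move=> dw; have dSp := dS phi; move: dSp.
  set G := fine (L2sq (dom P) (grad phi));
    set B := fine (L2sq (dom P) (hess phi)).
  move=> dSp.
  have G0 : 0 <= G by apply: fine_ge0; exact: L2sq_ge0.
  have B0 : 0 <= B by apply: fine_ge0; exact: L2sq_ge0.
  have -> : N = Num.sqrt (A + S ^+ 2) by apply: EFin_inj; rewrite -NE nE.
  (* With the same [t] in both estimates the four squares group as [t / 2 * (A + S ^+ 2)] and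
     [(2 * t)^-1 * (G + B)]. *)
  apply: le_sqrt_mul; rewrite ?addr_ge0 ?sqr_ge0// => t t0.
  rewrite (nn_functional_divdiv ht hw dw) (le_trans (ler_normB _ _))//.
  have h1 := vintR_ddot_le oO t2 (hess_L2mx phi) t0.
  rewrite -/A -/B in h1.
  have h2 : S * Num.sqrt G <= t / 2 * S ^+ 2 + (2 * t)^-1 * G.
    rewrite -[in leRHS](sqr_sqrtr G0); set g := Num.sqrt G.
    rewrite -subr_ge0.
    have -> : t / 2 * S ^+ 2 + (2 * t)^-1 * g ^+ 2 - S * g =
        (2 * t)^-1 * (t * S - g) ^+ 2 by field; rewrite gt_eqF.
    by rewrite mulr_ge0 ?sqr_ge0// invr_ge0 mulr_ge0// ltW.
  apply: (le_trans (lerD h1 (le_trans dSp h2))).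
  by rewrite le_eqVlt; apply/orP; left; apply/eqP; ring.
(* The infimum over [phi] is reached after dividing by [N]; for [N] equal to 0 any single
   representative already gives the claim. *)
have [NN|N1] := eqVneq N 0.
  by have [[_ [phi dw]] _] := hw; have := key _ dw; rewrite NN !mul0r.
have Ngt0 : 0 < N by rewrite lt_neqAle eq_sym N1.
rewrite mulrC -ler_pdivrMr// -lee_fin -IE;
  apply: le_ereal_inf_tmp => _ [phi dw <-].
rewrite -(fineK (L2mx_fin oO (grad_L2mx phi))) -(fineK (L2mx_fin oO (hess_L2mx
  phi))).
by rewrite -EFinD lee_fin ler_pdivrMr// mulrC; exact: key.
Qed.

Lemma Hn12_dual_norm_le (R : realType) (P : polyhedral_domain R)
    (D : set (faces P)) (i : faces P) (g : ('rV[R]_3 -> R) -> R) (C : R) :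
  0 <= C ->
  (forall w I, Hn12_face D i w -> Hn12_norm D w = I%:E -> g w <= C * I) ->
  (Hn12_dual_norm D i g <= C%:E)%E.
Proof.
move=> C0 gC; apply: ge_ereal_sup => _ [w hw <-].
have [I I0 IE] := Hn12_normP hw.1.
by rewrite IE; apply: ratio_le => //; exact: gC.
Qed.

Lemma le_Hn12_dual_norm (R : realType) (P : polyhedral_domain R)
    (D : set (faces P)) (i : faces P) (g : ('rV[R]_3 -> R) -> R) (C I : R) w :
  (Hn12_dual_norm D i g <= C%:E)%E ->
  Hn12_face D i w -> 0 <= I -> Hn12_norm D w = I%:E -> g w <= C * I.
Proof.
move=> gC hw I0 IE; apply: le_of_ratio => //; rewrite -IE.
by apply: le_trans gC; apply: ereal_sup_ubound; exists w.
Qed.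

(** For fixed [w] a bounded linear extension is Lipschitz in [h], with the constant [C * I]. This is
    what makes the trace unique. *)
Lemma nn_trace_extension_value (R : realType) (P : polyhedral_domain R)
    (D : set (faces P)) (i : faces P) (H : completeNormedModType R)
    (iota : ('rV[R]_3 -> 'M[R]_3) -> H) (T : H -> ('rV[R]_3 -> R) -> R) h w :
  nn_trace_extension D i iota T -> Hn12_face D i w ->
  extension_value (smooth_Hdd D) iota (fun tau => nn_functional i tau w) h (T h
    w).
Proof.
move=> [_ Tlin Tiota [C TC]] hw.
have [I I0 IE] := Hn12_normP hw.1.
have T0 : T 0 w = 0.
  have := Tlin 1 0 0 w hw; rewrite scaler0 addr0 mul1r => /eqP.
  by rewrite -subr_eq0 opprD addNKr oppr_eq0 => /eqP.
(* The dual norm bounds [T g w] only from above; the lower bound comes from oddness in [g]. *)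
have TN g : T (- g) w = - T g w.
  by have := Tlin (-1) g 0 w hw; rewrite scaleN1r addr0 T0 addr0 mulN1r.
have Tle g : `|T g w| <= C * I * `|g|.
  have b g' : T g' w <= C * I * `|g'|.
    by rewrite mulrAC; exact: le_Hn12_dual_norm (TC g') hw I0 IE.
  by rewrite ler_norml lerNl -TN b andbT -[`|g|]normrN b.
exists (C * I) => tau ht; rewrite -Tiota//.
have -> : T (iota tau) w - T h w = T (iota tau - h) w; last exact: Tle.
by have := Tlin (-1) h (iota tau) w hw; rewrite scaleN1r mulN1r addrC => ->;
  rewrite addrC.
Qed.

Unset Implicit Arguments.
Set Strict Implicit.
Set Printing Implicit Defensive.

Theorem theorem3 (R : realType) (P : polyhedral_domain R)
    (D : set (faces P)) (hD : dirichlet_part D) (i : faces P) :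
  exists c : R,
    (forall tau, smooth_Hdd D tau ->
       Hn12_dual D i (nn_functional i tau) /\
       (Hn12_dual_norm D i (nn_functional i tau) <= c%:E * normdd D tau)%E) /\
    (forall (H : completeNormedModType R)
       (iota : ('rV[R]_3 -> 'M[R]_3) -> H), is_Hdivdiv D iota ->
       exists T : H -> ('rV[R]_3 -> R) -> R,
         [/\ nn_trace_extension D i iota T,
             (forall h, (Hn12_dual_norm D i (T h) <= (c * `|h|)%:E)%E) &
             forall T', nn_trace_extension D i iota T' ->
               forall h w, Hn12_face D i w -> T' h w = T h w]).
Proof.
exists 1; split=> [tau ht|H iota [ilin inorm idense]].
  have [S [_ NE _ _]] := normddP ht; set N := Num.sqrt _ in NE.
  have le : (Hn12_dual_norm D i (nn_functional i tau) <= N%:E)%E.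
    apply: Hn12_dual_norm_le => [|w I hw IE]; first exact: sqrtr_ge0.
    exact: le_trans (ler_norm _) (nn_functional_bound ht hw NE IE).
  rewrite mul1e NE; do !split => //; last exact: le_lt_trans le (ltry _).
  by move=> a w1 w2 [h1 _] [h2 _]; exact: (nn_functional_linr i a ht h1 h2).
pose L w tau := nn_functional i tau w.
have Llin w : Hn12_face D i w -> linear_on (smooth_Hdd D) iota (L w).
  move=> [hw _] a x x' Ex Ex'; exists (fun y => a *: x y + x' y).
  by split; [exact: smooth_Hdd_lin|exact: ilin|exact: (nn_functional_linl i a
    Ex Ex' hw)].
(* The constant of [L w] is the norm of [w] itself, so passing to the completion preserves the dual
   bound with constant 1. *)
have Lle w I : Hn12_face D i w -> Hn12_norm D w = I%:E ->
    forall tau, smooth_Hdd D tau -> `|L w tau| <= I * `|iota tau|.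
  move=> hw IE tau ht; rewrite mulrC; apply: (nn_functional_bound ht hw) => //.
  by rewrite inorm.
have E0 : smooth_Hdd D !=set0.
  by have [tau ht _] := dense_approx 0 idense ltr01; exists tau.
(* Outside [Hn12_face] an extension value may fail to exist, and [xget] then returns 0; the dual
   space only looks at [w] in [Hn12_face]. *)
pose T h w := xget 0 [set y | extension_value (smooth_Hdd D) iota (L w) h y].
have TP h w : Hn12_face D i w ->
    extension_value (smooth_Hdd D) iota (L w) h (T h w).
  move=> hw; have [I I0 IE] := Hn12_normP hw.1.
  apply: (@xgetPex _ 0 [set y | extension_value _ _ _ _ y]).
  exact: extension_value_exists (Llin _ hw) I0 (Lle _ _ hw IE) E0.
have Tle h : (Hn12_dual_norm D i (T h) <= (1 * `|h|)%:E)%E.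
  apply: Hn12_dual_norm_le => [|w I hw IE]; first by rewrite mul1r.
  have [J J0 JE] := Hn12_normP hw.1.
  have I0 : 0 <= I by rewrite -lee_fin -IE JE lee_fin.
  apply: le_trans (ler_norm _) _; rewrite mul1r mulrC.
  exact: extension_value_le idense I0 (Lle _ _ hw IE) (TP h w hw).
exists T; split => //; last first.
  move=> T' hT' h w hw; apply: (extension_value_unique idense) (TP h w hw).
  exact: nn_trace_extension_value.
split => //; last by exists 1.
- move=> h; split; last exact: le_lt_trans (Tle h) (ltry _).
  move=> a w1 w2 h1 h2.
  have ext : extension_value (smooth_Hdd D) iota (L (fun x => a * w1 x +
    w2 x)) h
      (a * T h w1 + T h w2).
    apply: extension_valueDl (TP h w1 h1) (TP h w2 h2) => tau ht.
    exact: (nn_functional_linr i a ht h1.1 h2.1).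
  apply: (extension_value_unique idense _ ext).
  by apply: (@xgetPex _ 0 [set y | extension_value _ _ _ _ y]); eexists;
    exact: ext.
- move=> a h1 h2 w hw; have [I I0 IE] := Hn12_normP hw.1.
  apply: (extension_value_unique idense) (TP _ w hw) _.
  exact: extension_valueDr idense (Llin _ hw) I0 (Lle _ _ hw IE) (TP h1 w hw)
    (TP h2 w hw).
- move=> tau w ht hw; have [I I0 IE] := Hn12_normP hw.1.
  apply: (extension_value_unique idense) (TP _ w hw) _.
  exact: extension_value_point (Llin _ hw) (Lle _ _ hw IE) ht.
Qed.
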